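(* Let $\theta>0$. For each $n$ let $a_{n1},\dots,a_{nn}\in\mathbb{Z}$, write $a_j=a_{nj}$, and let $h_n(\sigma)=\sum_{j\le n}a_jk_j(\sigma)$. Assume \[ \sum_{j<n}\frac{\mathbf{1}\{a_j\le -1\}}{j}\Big(1-\frac{j}{n}\Big)^{\theta-1}=o(1)\qquad(n\to\infty). \] If there exists a sequence $\Upsilon(l)$, $l\ge 0$, with $\Upsilon(0)=1$, such that for every $l\in\mathbb{N}$ \[ \lim_{m\to\infty}\limsup_{n\to\infty}\big|\Upsilon_n(l,m)-\Upsilon(l)\big|=0, \] and $\sum_{l=0}^\infty \Upsilon(l)2^l/l!<\infty$, then there is a random variable $Y$ taking values in $\mathbb{Z}_+$ such that $T_n(x):=\nu_n(h_n(\sigma)<x)$ converges weakly to $F_Y(x)$ and $\mathbf{E}Y_{(l)}=\Upsilon(l)$ for all $l\ge1$.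
   Context: $\mathbf{S}_n$ is the symmetric group; $k_j(\sigma)$ is the number of cycles of length $j$ of $\sigma$ and $w(\sigma)$ its number of cycles. For fixed $\theta>0$ the Ewens measure is $\nu_n(A)=\frac{1}{\theta^{(n)}}\sum_{\sigma\in A}\theta^{w(\sigma)}$, $\theta^{(n)}=\theta(\theta+1)\cdots(\theta+n-1)$. $F_Y$ is the distribution function of $Y$. $x_{(r)}=x(x-1)\cdots(x-r+1)$, $x_{(0)}=1$. For $m\in\mathbb{N}$ put $b_j=b_j(m):=\min\{\max\{a_j,0\},m\}$ and \[ \Upsilon_n(l,m):=\sum_{u=1}^l\theta^u\sum_{\substack{r_1+\cdots+r_u=l\\ 1\le r_i\le m}}\binom{l-1}{r_1-1}\binom{l-r_1-1}{r_2-1}\cdots\binom{l-r_1-\cdots-r_{u-1}-1}{r_u-1}\sum_{\substack{j_1,\dots,j_u\ge1\\ j_1+\cdots+j_u<n}}\frac{(b_{j_1})_{(r_1)}\cdots(b_{j_u})_{(r_u)}}{j_1\cdots j_u}\Big(1-\frac{j_1+\cdots+j_u}{n}\Big)^{\theta-1}. \] *)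

(* Defs.v *)
From HB Require Import structures.
From mathcomp Require Import all_boot all_order all_algebra all_fingroup.
From mathcomp Require Import all_classical all_reals all_analysis.
Set Implicit Arguments. Unset Strict Implicit. Unset Printing Implicit Defensive.
Import Order.TTheory GRing.Theory Num.Theory.
Import numFieldNormedType.Exports.
Local Open Scope ring_scope.

Definition kcyc (n j : nat) (s : {perm 'I_n}) : nat :=
  #|[set c in porbits s | #|c| == j]|.

Definition wcyc (n : nat) (s : {perm 'I_n}) : nat := #|porbits s|.

Definition rising {R : realType} (th : R) (n : nat) : R :=
  \prod_(i < n) (th + i%:R).

Definition ewens {R : realType} (th : R) (n : nat) (A : pred {perm 'I_n}) : R :=
  (\sum_(s : {perm 'I_n} | A s) th ^+ wcyc s) / rising th n.

Definition hn (a : nat -> nat -> int) (n : nat) (s : {perm 'I_n}) : int :=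
  \sum_(1 <= j < n.+1) a n j * (kcyc j s)%:Z.

Definition Tn {R : realType} (th : R) (a : nat -> nat -> int) (n : nat) (x : R) : R :=
  ewens th (fun s : {perm 'I_n} => (hn a s)%:~R < x).

Definition bcut (a : nat -> nat -> int) (n m j : nat) : nat :=
  minn (absz (Num.max (a n j) 0)) m.

Definition binprod (l u : nat) (r : 'I_u -> nat) : nat :=
  \prod_(i < u) 'C(l - (\sum_(k < u | (k < i)%N) r k) - 1, r i - 1).

Definition Ups {R : realType} (th : R) (a : nat -> nat -> int) (n l m : nat) : R :=
  \sum_(1 <= u < l.+1) th ^+ u *
    \sum_(r : {ffun 'I_u -> 'I_l.+1} |
            ((\sum_(i < u) (r i : nat))%N == l)
            && [forall i, (0 < r i)%N && (r i <= m)%N])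
      ((binprod l (fun i => (r i : nat)))%:R *
       \sum_(j : {ffun 'I_u -> 'I_n} |
               [forall i, (0 < j i)%N] && (\sum_(i < u) (j i : nat) < n)%N)
         ((\prod_(i < u) (bcut a n m (j i)) ^_ (r i))%:R
            / (\prod_(i < u) (j i : nat))%:R
            * powR (1 - (\sum_(i < u) (j i : nat))%:R / n%:R) (th - 1))).

(* distribution function F_Y(x) = P(Y <= x) of a Z_+-valued Y with
   law p (P(Y = k) = p k) *)
Definition cdf_nat {R : realType} (p : nat -> R) (x : R) : R :=
  limn (series (fun k : nat => if k%:R <= x then p k else 0)).

(* Main.v *)
(** Write [h^m] for the sum of [min (max a_j 0) m * k_j].  Marking one cycle of
a permutation shows that its [l]-th factorial moments under the Ewens measure satisfy
[M_n(l+1) = sum_j th/j sum_i C(l,i) (b_j)_(i+1) M_{n-j}(l-i)], and peeling off the first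
index shows that [Upsilon_n(l,m)] satisfies the same recursion, with the initial value
[th^(k)/k!] (relative to [th^(n)/n!]) replaced by [(k/n)^(th-1)].  These agree up to a
relative error [O(1/k)], and each step of the recursion costs only a factor [log n],
because [1/(j(k+1)) = (1/j + 1/(k+1))/(j+k+1)].  Hence [E (h^m)_(l)] tends to [Upsilon(l)]
in the iterated limit.  Since [h] and [h^m] differ only if a cycle with negative weight
occurs or [h^m >= m], Bonferroni's inequalities and [Upsilon(l) 2^l / l! -> 0] make
[P(h = k)] Cauchy, and [X_(l) 1{X >= K} <= X_(l+1)/(K - l)] shows that no mass or
factorial moment is lost in the limit. *)
Require Import Defs.
From HB Require Import structures.
From mathcomp Require Import all_boot all_order all_algebra all_fingroup.
From mathcomp Require Import all_classical all_reals all_analysis.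
From mathcomp Require Import ring lra zify.
Set Implicit Arguments. Unset Strict Implicit. Unset Printing Implicit Defensive.
Import Order.TTheory GRing.Theory Num.Theory.
Import numFieldNormedType.Exports.
Local Open Scope ring_scope.

(** * Cycle-index recursion for permutations *)

Lemma porbit_closed (T : finType) (s : {perm T}) (D : {set T}) z :
  z \in D -> (forall w, w \in D -> s w \in D) -> porbit s z \subset D.
Proof.
move=> zD sD; apply/fintype.subsetP => _ /porbitP[i ->].
elim: i => [|i IHi]; first by rewrite expg0 perm1.
by rewrite expgSr permM; apply: sD.
Qed.

Lemma porbit_image (T : finType) (s : {perm T}) z w :
  (s w \in porbit s z) = (w \in porbit s z).
Proof. by rewrite -[s w]/(aperm w s) -{1}(expg1 s) porbit_sym porbit_perm porbit_sym. Qed.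

(** * Inserting a fixed point into a cycle *)

Section Insertion.
Variables (T : finType) (s : {perm T}) (x x1 : T).
Hypotheses (sx : s x = x) (x1x : x1 != x).

Lemma insert_notin : x \notin porbit s x1.
Proof.
apply/negP => xo.
have : porbit s x \subset [set x].
  by apply: porbit_closed; rewrite ?inE // => w /finset.set1P ->; rewrite sx inE.
move/fintype.subsetP/(_ x1); rewrite porbit_sym in xo.
by move=> /(_ xo); rewrite inE (negbTE x1x).
Qed.

(** The product sends [x] to [x1] and the [s]-preimage of [x1] to [x], so [x] enters the cycle of
    [x1] just before [x1]. *)
Lemma porbit_insert : porbit (s * tperm x x1) x = x |: porbit s x1.
Proof.
set t := (s * _)%g.
have tx : t x = x1 by rewrite permM sx tpermL.
apply/eqP; rewrite finset.eqEsubset; apply/andP; split.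
  apply: porbit_closed; first by rewrite !inE eqxx.
  move=> w; rewrite !inE => /predU1P[->|wo]; first by rewrite tx porbit_id orbT.
  rewrite permM; case: tpermP => [_|_|/eqP swx _]; rewrite ?porbit_id ?eqxx ?orbT //.
  by rewrite porbit_image wo orbT.
have sub : porbit s x1 \subset porbit t x.
  (* Closure is proved for the intersection: for [w] in [porbit s x1] the point [s w] differs from
     [x], so the transposition acts only when [s w] is [x1]. *)
  have : porbit s x1 \subset porbit s x1 :&: porbit t x.
    apply: porbit_closed; first by rewrite inE porbit_id -tx porbit_image porbit_id.
    move=> w /finset.setIP[wo wt]; rewrite inE porbit_image wo /=.
    case: (eqVneq (s w) x1) => [->|sw1]; first by rewrite -tx porbit_image porbit_id.
    suff -> : s w = t w by rewrite porbit_image.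
    rewrite permM tpermD // 1?eq_sym //.
    apply: contraNneq insert_notin => <-; by rewrite porbit_image.
  by rewrite finset.subsetI => /andP[].
by rewrite finset.subUset sub andbT finset.sub1set porbit_id.
Qed.

(** Iterates of [s] from [z] never reach [x] or [x1], so the transposition never acts on them. *)
Lemma porbit_insert_out z : z \notin x |: porbit s x1 ->
  porbit (s * tperm x x1) z = porbit s z.
Proof.
move=> zo.
have H i : ((s * tperm x x1) ^+ i)%g z = (s ^+ i)%g z.
  elim: i => [|i IHi]; first by rewrite !expg0.
  rewrite !expgSr !permM IHi tpermD //.
    apply: contraNneq zo => xe; rewrite !inE; apply/orP; left.
    have : s ((s ^+ i)%g z) = s x by rewrite -xe sx.
    move/perm_inj => e; have {}e : (s ^+ i)%g z = (s ^+ i)%g x.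
      rewrite e; elim: {xe e IHi} i => [|i IHi]; first by rewrite perm1.
      by rewrite expgSr permM -IHi sx.
    by rewrite (perm_inj e).
  apply: contraNneq zo => ->; rewrite !inE.
  by rewrite porbit_sym porbit_image -/(aperm _ _) porbit_sym porbit_perm porbit_id orbT.
by apply/setP => w; apply/porbitP/porbitP => -[i ->]; exists i; rewrite H.
Qed.

End Insertion.

(** * Cycle weights and the exponential formula *)

Section CycleWeight.
Variables (A : comNzRingType) (y : nat -> A) (T : finType).
Implicit Types (B : {set T}) (x : T) (k : nat).

(** Permutations of [B] are encoded as permutations of [T] supported in [B]; the condition on [c]
    discards the fixed points outside [B] and keeps those inside. *)
Definition cycle_weight B : A :=
  \sum_(s : {perm T} | perm_on B s)
     \prod_(c in porbits s | c \subset B) y #|c|.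

(* The marked cycle, through [x], is counted as if it had [k] more points. *)
Definition marked_weight B x k : A :=
  \sum_(s : {perm T} | perm_on B s) y (#|porbit s x| + k)%N *
     \prod_(c in porbits s | (c \subset B) && (x \notin c)) y #|c|.

Lemma porbits_eq (s : {perm T}) c x : c \in porbits s -> (c == porbit s x) = (x \in c).
Proof.
by case/imsetP => z _ ->; rewrite -eq_porbit_mem.
Qed.

Lemma cycle_weight_marked B x : x \in B -> cycle_weight B = marked_weight B x 0.
Proof.
move=> xB; apply: eq_bigr => s sB.
have osB : porbit s x \subset B.
  by apply: porbit_closed => // w wB; rewrite (perm_closed _ sB).
rewrite (bigD1 (porbit s x)) ?mem_porbits ?imset_f //= ?addn0; congr (_ * _).
apply: eq_bigl => c; case cs: (c \in porbits s) => //=.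
by rewrite porbits_eq.
Qed.

(** Sort by [x1 = s x]. If [x] is fixed, its cycle closes with [k.+1] counted points; otherwise
    deleting [x] leaves a permutation of [B :\ x] whose marked cycle passes through [x1], and [k]
    absorbs the lost point. *)
Lemma marked_weight_rec B x k : x \in B ->
  marked_weight B x k = y k.+1 * cycle_weight (B :\ x) +
     \sum_(x1 in B :\ x) marked_weight (B :\ x) x1 k.+1.
Proof.
move=> xB; rewrite /marked_weight.
rewrite (partition_big (fun s : {perm T} => s x) (mem B)); last first.
  by move=> s sB; rewrite /= (perm_closed _ sB).
(* Right multiplication by [tperm x x1] is an involution exchanging the permutations with [s x = x1]
   and those fixing [x]. *)
have step x1 : x1 \in B -> forall F : {perm T} -> A,
  \sum_(s | perm_on B s && (s x == x1)) F s =
  \sum_(s | perm_on (B :\ x) s) F (s * tperm x x1)%g.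
  move=> x1B F.
  have inv : involutive (fun s : {perm T} => (s * tperm x x1)%g).
    by move=> s /=; rewrite -mulgA tperm2 mulg1.
  rewrite (reindex_inj (inv_inj inv)); apply: eq_bigl => s.
  have -> : ((s * tperm x x1)%g x == x1) = (s x == x).
    by rewrite permM -(inj_eq (@perm_inj _ (tperm x x1))) tpermK tpermR.
  have tB : perm_on B (tperm x x1).
    by apply/fintype.subsetP => z; rewrite inE; case: tpermP => [->|->|]; rewrite ?eqxx.
  apply/andP/idP => [[stB /eqP sx]|sB'].
    have sB : perm_on B s by rewrite -[s]inv perm_onM.
    apply/fintype.subsetP => z; rewrite !inE => sz; apply/andP; split.
      by apply: contraNneq sz => ->; rewrite sx.
    by apply: (fintype.subsetP sB); rewrite inE.
  have sB : perm_on B s by apply: fintype.subset_trans sB' (finset.subsetDl _ _).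
  by rewrite perm_onM // (out_perm sB') ?eqxx // !inE eqxx.
have sfix s : perm_on (B :\ x) s -> s x = x by move=> H; rewrite (out_perm H) // !inE eqxx.
rewrite (bigD1 x) //= step //; congr (_ + _).
  rewrite /cycle_weight mulr_sumr; apply: eq_bigr => s sB; rewrite tperm1 mulg1.
  have -> : porbit s x = [set x].
    apply/eqP; rewrite finset.eqEsubset finset.sub1set porbit_id andbT.
    by apply: porbit_closed; rewrite ?inE // => w /finset.set1P ->; rewrite sfix ?inE.
  rewrite cards1 add1n; congr (_ * _); apply: eq_bigl => c.
  by rewrite finset.subsetD1.
apply: eq_big => [x1|x1 /andP[x1B x1x]]; first by rewrite !inE andbC.
rewrite step //; apply: eq_bigr => s sB.
rewrite porbit_insert ?sfix // cardsU1 insert_notin ?sfix // add1n addSnnS; congr (_ * _).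
apply: eq_bigl => c; rewrite finset.subsetD1 -!andbA.
have sx := sfix _ sB.
apply/and3P/and4P => [[/imsetP[z _ cz] cB xc]|[/imsetP[z _ cz] cB xc x1c]].
  have zo : z \notin x |: porbit s x1.
    rewrite -porbit_insert //; apply: contra xc => xz; by rewrite cz porbit_sym.
  have cz' : c = porbit s z by rewrite cz porbit_insert_out.
  split=> //; first by rewrite cz' imset_f.
  by rewrite cz' porbit_sym; apply: contra zo; rewrite !inE => ->; rewrite orbT.
have zo : z \notin x |: porbit s x1.
  rewrite !inE negb_or; apply/andP; split.
    by apply: contra xc => /eqP <-; rewrite cz porbit_id.
  by rewrite porbit_sym -cz.
split=> //; by rewrite cz -(porbit_insert_out sx zo) imset_f.
Qed.

Variable Z : nat -> A.
Hypothesis Z0 : Z 0 = 1.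
Hypothesis ZS : forall n, n.+1%:R * Z n.+1 = \sum_(j < n.+1) y j.+1 * Z (n - j)%N.

(* [n Z_n = sum_j y_j Z_{n-j}] unrolls the one-point removal of [marked_weight_rec]. *)
Lemma weightE n : (forall B, #|B| = n -> cycle_weight B = n`!%:R * Z n) /\
  (forall B x k, x \in B -> #|B| = n ->
     marked_weight B x k = n.-1`!%:R * \sum_(j < n) y (j.+1 + k)%N * Z (n.-1 - j)%N).
Proof.
elim: n => [|n [IH1 IH2]].
  split=> [B /eqP|B x k xB /eqP]; rewrite cards_eq0 => /eqP B0; last first.
    by rewrite B0 inE in xB.
  rewrite B0 /cycle_weight (big_pred1 1%g).
    rewrite big1 ?Z0 ?mulr1 // => c /andP[/imsetP[z _ ->]].
    by rewrite finset.subset0 => /eqP o0; have := porbit_id 1%g z; rewrite o0 inE.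
  move=> s; rewrite /=; apply/idP/eqP => [s0|->]; last exact: perm_on1.
  by apply/permP => z; rewrite perm1 (out_perm s0) ?inE.
have H2 B x k : x \in B -> #|B| = n.+1 ->
     marked_weight B x k = n`!%:R * \sum_(j < n.+1) y (j.+1 + k)%N * Z (n - j)%N.
  move=> xB cB; have cB' : #|B :\ x| = n by move: cB; rewrite (cardsD1 x) xB add1n => -[].
  rewrite marked_weight_rec // IH1 // big_ord_recl subn0 add1n mulrDr; congr (_ + _).
    by rewrite mulrCA.
  under eq_bigr => x1 x1B do rewrite (IH2 _ _ _ x1B cB').
  rewrite sumr_const cB'; case: n {IH1 IH2 cB cB'} => [|n]; first by rewrite mulr0n big_ord0 mulr0.
  rewrite -[LHS]mulr_natl mulrA -natrM -factS; congr (_ * _).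
  by apply: eq_bigr => i _; rewrite addnS.
split=> // B cB; have /card_gt0P[x xB] : (0 < #|B|)%N by rewrite cB.
rewrite (cycle_weight_marked xB) H2 // factS natrM mulrAC ZS mulrC; congr (_ * _).
by apply: eq_bigr => i _; rewrite addn0.
Qed.

End CycleWeight.

(** The exponential formula: the recursion characterises $\sum_n Z_n t^n=\exp(\sum_j y_j t^j/j)$,
    the generating function of the cycle index. *)
Lemma sum_perm_weight (A : comNzRingType) (y Z : nat -> A) n :
  Z 0 = 1 -> (forall n, n.+1%:R * Z n.+1 = \sum_(j < n.+1) y j.+1 * Z (n - j)%N) ->
  \sum_(s : {perm 'I_n}) \prod_(c in porbits s) y #|c| = n`!%:R * Z n.
Proof.
move=> Z0 ZS; have [/(_ [set: 'I_n]%SET) + _] := weightE 'I_n Z0 ZS n.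
rewrite cardsT card_ord => <- //; apply: eq_big => [s|s _].
  by apply/esym/fintype.subsetP => z _; rewrite inE.
by apply: eq_bigl => c; rewrite finset.subsetT andbT.
Qed.

Lemma cycle_recursion_ex (F : numFieldType) (A : comAlgType F) (y : nat -> A) :
  exists Z : nat -> A, Z 0%N = 1 /\
    forall n, n.+1%:R * Z n.+1 = \sum_(j < n.+1) y j.+1 * Z (n - j)%N.
Proof.
(* [zs n] lists $Z_n,\dots,Z_0$, newest first, so entry [j] of [zs n'] is $Z_{n'-j}$. *)
pose zs := fix zs n : seq A := if n is n'.+1 then
  (n'.+1%:R^-1 *: \sum_(j < n'.+1) y j.+1 * (zs n')`_j) :: zs n' else [:: 1].
exists (fun n => (zs n)`_0); split=> // n /=.
rewrite mulr_natl -scaler_nat scalerA divff ?pnatr_eq0 // scale1r.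
apply: eq_bigr => -[j /= jn] _; congr (_ * _).
elim: n j jn => [|n IHn] [|j] //= jn; by rewrite IHn // subSS.
Qed.

(** Both sides run over $i+j<n$; the inner sum for $j=n$ is empty. *)
Lemma sum_triangle (A : nmodType) n (F : nat -> nat -> A) :
  \sum_(j < n.+1) \sum_(i < n - j) F j i = \sum_(i < n) \sum_(j < n - i) F j i.
Proof.
rewrite big_ord_recr /= subnn big_ord0 addr0.
under eq_bigr => j _ do rewrite (big_ord_widen n) ?leq_subr //.
under [RHS]eq_bigr => j _ do rewrite (big_ord_widen n (fun i => F i j)) ?leq_subr //.
rewrite (exchange_big_dep xpredT) //=; apply: eq_bigr => i _; apply: eq_bigl => j.
by rewrite ltn_subRL ltn_subRL addnC.
Qed.

Lemma coef_1pX_exp (R : comNzRingType) k l : ((1 + 'X) ^+ k : {poly R})`_l = 'C(k, l)%:R.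
Proof.
elim: k l => [|k IHk] l; first by rewrite expr0 coef1 bin0n.
rewrite exprS mulrDl mul1r coefD coefXM !IHk.
by case: l => [|l]; rewrite ?bin0 ?addr0 // binS natrD.
Qed.

(** * Factorial moments under the Ewens measure *)

Definition cyc_sum (b : nat -> nat) n (s : {perm 'I_n}) : nat :=
  (\sum_(c in porbits s) b #|c|)%N.

(** This is the Ewens factorial moment multiplied by $\theta^{(n)}/n!$; dividing by $n!$ instead of
    $\theta^{(n)}$ turns the recursion in [fmomS] into a pure convolution. *)
Definition fmom (R : numFieldType) (th : R) (b : nat -> nat) (n l : nat) : R :=
  (\sum_(s : {perm 'I_n}) th ^+ wcyc s * (cyc_sum b s ^_ l)%:R) / n`!%:R.

Section FactorialMoments.
Variables (R : numFieldType) (th : R) (b : nat -> nat).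

(** The coefficient of $X^l$ in $(1+X)^b$ is $b_{(l)}/l!$, so with these weights [Z] generates the
    factorial moments. *)
Let y j : {poly R} := th *: (1 + 'X) ^+ b j.

Lemma prod_cycle_weight n (s : {perm 'I_n}) :
  \prod_(c in porbits s) y #|c| = th ^+ wcyc s *: (1 + 'X) ^+ cyc_sum b s.
Proof.
rewrite /cyc_sum expr_sum -mul_polyC rmorphXn /= -prodr_const -big_split /=.
by apply: eq_bigr => c _; rewrite mul_polyC.
Qed.

Section Recursion.
Variable Z : nat -> {poly R}.
Hypothesis Z0 : Z 0%N = 1.
Hypothesis ZS : forall n, n.+1%:R * Z n.+1 = \sum_(j < n.+1) y j.+1 * Z (n - j)%N.

(** Formally, $\partial_X\exp(\sum_j y_jt^j/j)=(\sum_j y_j't^j/j)\exp(\sum_j y_jt^j/j)$. In the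
    induction the two halves of the differentiated recursion carry the factors $1$ and
    $(n-i)/(i+1)$, which add up to $(n+1)/(i+1)$. *)
Lemma cycle_gf_deriv n :
  (Z n)^`() = \sum_(j < n) j.+1%:R^-1 *: (y j.+1)^`() * Z (n - j.+1)%N.
Proof.
elim/ltn_ind: n => -[|n] IHn; first by rewrite Z0 derivC big_ord0.
apply: (@scalerI _ _ n.+1%:R); first by rewrite pnatr_eq0.
rewrite !scaler_nat -derivMn -mulr_natl ZS raddf_sum /=.
under eq_bigr => j _ do rewrite derivM.
rewrite big_split /=.
have -> : \sum_(j < n.+1) y j.+1 * (Z (n - j))^`() =
          \sum_(j < n.+1) \sum_(i < n - j) y j.+1 * (i.+1%:R^-1 *: (y i.+1)^`() * Z (n - j - i.+1)%N).
  by apply: eq_bigr => j _; rewrite IHn ?ltnS ?leq_subr // mulr_sumr.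
rewrite (sum_triangle n (fun j i => y j.+1 * (i.+1%:R^-1 *: (y i.+1)^`() * Z (n - j - i.+1)%N))).
have -> : \sum_(i < n) \sum_(j < n - i) y j.+1 * (i.+1%:R^-1 *: (y i.+1)^`() * Z (n - j - i.+1)%N)
   = \sum_(i < n.+1) i.+1%:R^-1 *: (y i.+1)^`() * ((n - i)%:R * Z (n - i)%N).
  rewrite [RHS]big_ord_recr /= subnn mul0r mulr0 addr0; apply: eq_bigr => i _.
  have := ltn_ord i; rewrite -subn_gt0; case def: (n - i)%N => [//|k] _.
  rewrite ZS mulr_sumr; apply: eq_bigr => j _; rewrite mulrCA; congr (_ * (_ * Z _)).
  by rewrite -subnDA addnC subnDA subnS def.
rewrite -big_split -sumrMnl; apply: eq_bigr => i _ /=.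
rewrite subSS -!scalerAl mulr_natl mulrnAr !scalerMnr -[X in X + _]scale1r.
set P := _ * _; rewrite -[P *+ (n - i)]scaler_nat -[P *+ n.+1]scaler_nat !scalerA -scalerDl.
congr (_ *: _); rewrite -[X in X + _](@mulVf _ i.+1%:R) ?pnatr_eq0 // -mulrDr -natrD.
by rewrite addSn subnKC // -ltnS.
Qed.

Lemma fmom_coef n l : fmom th b n l = l`!%:R * (Z n)`_l.
Proof.
have nf0 : n`!%:R != 0 :> R by rewrite pnatr_eq0 -lt0n fact_gt0.
apply: (mulfI nf0); rewrite /fmom mulrC divfK // mulrCA.
have -> : n`!%:R * (Z n)`_l = (n`!%:R * Z n)`_l by rewrite [in RHS]mulr_natl coefMn mulr_natl.
rewrite -(sum_perm_weight n Z0 ZS) coef_sum mulr_sumr; apply: eq_bigr => s _.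
rewrite prod_cycle_weight coefZ coef_1pX_exp mulrCA; congr (_ * _).
by rewrite -natrM mulnC bin_ffact.
Qed.

End Recursion.

(* The cycle of a size-biased point has length [j] with weight [th/j] and the
   other cycles form an independent permutation of [n - j] points; expanding
   [X (X-1)_(l)], with [X = b_j + X'], by Vandermonde's identity gives this. *)
Lemma fmomS n l : fmom th b n l.+1 =
  \sum_(j < n) th / j.+1%:R * \sum_(i < l.+1)
     ('C(l, i) * b j.+1 ^_ i.+1)%:R * fmom th b (n - j.+1) (l - i).
Proof.
have [Z [Z0 ZS]] := cycle_recursion_ex y.
rewrite (fmom_coef Z0 ZS) factS mulnC natrM -mulrA [l.+1%:R * _]mulr_natl -coef_deriv.
rewrite cycle_gf_deriv // coef_sum mulr_sumr; apply: eq_bigr => j _.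
rewrite -scalerAl coefZ coefM mulrCA [th / _]mulrC -mulrA; congr (_ * _).
rewrite !mulr_sumr; apply: eq_bigr => i _.
rewrite (fmom_coef Z0 ZS) coef_deriv coefZ coef_1pX_exp -bin_ffact factS.
have il : (i <= l)%N by rewrite -ltnS.
by rewrite -(bin_fact il) !natrM -mulr_natr; ring.
Qed.

(** In degree 0 every weight is [th], so the recursion sums for consecutive indices differ by one
    term, giving $(m+1)z_{m+1}=\theta z_m+mz_m$. *)
Lemma fmom0 n : fmom th b n 0 = (\prod_(i < n) (th + i%:R)) / n`!%:R.
Proof.
have [Z [Z0 ZS]] := cycle_recursion_ex y.
have H m : m.+1%:R * (Z m.+1)`_0 = (th + m%:R) * (Z m)`_0.
  have c0 k : k.+1%:R * (Z k.+1)`_0 = \sum_(j < k.+1) th * (Z (k - j)%N)`_0.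
    rewrite [LHS]mulr_natl; have := congr1 (coefp 0) (ZS k); rewrite /= mulr_natl coefMn => ->.
    rewrite coef_sum; apply: eq_bigr => j _.
    by rewrite coef0M coefZ coef_1pX_exp bin0 mulr1.
  rewrite c0 big_ord_recl subn0 mulrDl; congr (_ + _).
  by case: m => [|m]; rewrite ?big_ord0 ?mul0r // c0.
rewrite (fmom_coef Z0 ZS) fact0 mul1r; elim: n => [|n IHn].
  by rewrite Z0 coef1 big_ord0 fact0 divr1.
have n0 : n.+1%:R != 0 :> R by rewrite pnatr_eq0.
apply: (mulfI n0); rewrite H IHn big_ord_recr factS natrM invfM /=.
by field; rewrite nat1r n0 pnatr_eq0 -lt0n fact_gt0.
Qed.

End FactorialMoments.

(** * Sums over compositions *)

Section FfunCons.
Variables (T : finType) (u : nat).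
Implicit Types (x : T) (g : {ffun 'I_u -> T}).

Definition fcons x g : {ffun 'I_u.+1 -> T} :=
  [ffun i => if unlift ord0 i is Some k then g k else x].

Lemma fcons0 x g : fcons x g ord0 = x.
Proof. by rewrite ffunE unlift_none. Qed.

Lemma fconsS x g k : fcons x g (lift ord0 k) = g k.
Proof. by rewrite ffunE liftK. Qed.

Lemma sum_fcons (A : nmodType) (F : {ffun 'I_u.+1 -> T} -> A) :
  \sum_f F f = \sum_x \sum_g F (fcons x g).
Proof.
rewrite pair_big /= (reindex (fun p => fcons p.1 p.2)) //=.
exists (fun f => (f ord0, [ffun k => f (lift ord0 k)])) => [[x g] _|f _] /=.
  by rewrite fcons0; congr pair; apply/ffunP => k; rewrite ffunE fconsS.
apply/ffunP => i; case: (unliftP ord0 i) => [k|] ->; last by rewrite fcons0.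
by rewrite fconsS ffunE.
Qed.

Lemma forall_fcons (P : pred T) x g :
  [forall i, P (fcons x g i)] = P x && [forall i, P (g i)].
Proof.
apply/forallP/andP => [H|[Px /forallP Pg] i].
  split; first by have := H ord0; rewrite fcons0.
  by apply/forallP => k; have := H (lift ord0 k); rewrite fconsS.
by case: (unliftP ord0 i) => [k|] ->; rewrite ?fcons0 ?fconsS.
Qed.

End FfunCons.

Lemma binprod_fcons l u (T : finType) (v : T -> nat) x (g : {ffun 'I_u -> T}) :
  binprod l (fun i => v (fcons x g i)) =
  ('C(l - 1, v x - 1) * binprod (l - v x) (fun i => v (g i)))%N.
Proof.
rewrite /binprod big_ord_recl /= fcons0 big1 ?subn0 => [|k]; last by rewrite ltn0.
congr (_ * _)%N; apply: eq_bigr => i _; rewrite fconsS.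
rewrite big_mkcond big_ord_recl /= fcons0 subnDA; congr 'C(_ - _ - 1, _).
rewrite [RHS]big_mkcond; apply: eq_bigr => k _; by rewrite fconsS /bump /= !add1n ltnS.
Qed.

Section CompositionSums.
Variables (F : numFieldType) (th : F) (b : nat -> nat) (f : nat -> F) (n L : nat).
Hypothesis f0 : f 0%N = 0.

(** The inner sums of [Ups], with a general function [f] of the remainder $N-\sum j_i$ as weight.
    Truncated subtraction and [f0] encode the condition $\sum j_i<N$. [N] is separate from the index
    bound [n], and [l] from [L], so that peeling off the first index leaves the index types
    unchanged. *)
Definition comp_sum u l N : F :=
  \sum_(r : {ffun 'I_u -> 'I_L.+1} |
      ((\sum_(i < u) (r i : nat))%N == l) && [forall i, 0 < r i]%N)
   (binprod l (fun i => (r i : nat)))%:R *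
   \sum_(j : {ffun 'I_u -> 'I_n} | [forall i, 0 < j i]%N)
     (\prod_(i < u) b (j i) ^_ (r i))%:R / (\prod_(i < u) (j i : nat))%:R
       * f (N - \sum_(i < u) (j i : nat)).

Lemma comp_sum0 l N : comp_sum 0 l.+1 N = 0.
Proof. by rewrite /comp_sum big_pred0 // => r; rewrite big_ord0. Qed.

Lemma comp_sum00 N : comp_sum 0 0 N = f N.
Proof.
rewrite /comp_sum (big_pred1 [ffun=> ord0]); last first.
  move=> r; rewrite big_ord0 eqxx /=; have -> : r = [ffun=> ord0] by apply/ffunP => -[].
  by rewrite /= eqxx; apply/forallP => -[].
rewrite /binprod big_ord0 mul1r.
case: n => [|n'].
  rewrite (big_pred1 [ffun i : 'I_0 => i]) ?big_ord0 ?subn0 ?divr1 ?mul1r //.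
  move=> r; have -> : r = [ffun i => i] by apply/ffunP => -[].
  by rewrite /= eqxx; apply/forallP => -[].
rewrite (big_pred1 [ffun=> ord0]) ?big_ord0 ?subn0 ?divr1 ?mul1r //.
move=> r; have -> : r = [ffun=> ord0] by apply/ffunP => -[].
by rewrite /= eqxx; apply/forallP => -[].
Qed.

Lemma comp_sum_N0 u l : comp_sum u l 0 = 0.
Proof.
rewrite /comp_sum big1 // => r _; rewrite big1 ?mulr0 // => j _.
by rewrite sub0n f0 mulr0.
Qed.

Lemma comp_sum_gt u l N : (l < u)%N -> comp_sum u l N = 0.
Proof.
move=> lu; rewrite /comp_sum big_pred0 // => r; apply/negP => /andP[/eqP rl /forallP r0].
move: lu; rewrite -rl ltnNge => /negP[].
by rewrite -{1}(card_ord u) -sum1_card leq_sum.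
Qed.

Lemma comp_sumS u l N :
  comp_sum u.+1 l N = \sum_(r < L.+1 | (0 < r <= l)%N) \sum_(j < n | (0 < j)%N)
    ('C(l - 1, r - 1) * b j ^_ r)%:R / j%:R * comp_sum u (l - r)%N (N - j)%N.
Proof.
rewrite {1}/comp_sum big_mkcond sum_fcons [RHS]big_mkcond; apply: eq_bigr => r1 _.
case: ifP => [/andP[r0 rl]|rn]; last first.
  apply: big1 => r _; rewrite big_ord_recl fcons0.
  rewrite (forall_fcons (fun r : 'I_L.+1 => (0 < r)%N)).
  case: ifP => // /andP[/eqP re /andP[r0 _]]; move: rn; rewrite r0 /= => /negP[].
  by rewrite -re leq_addr.
transitivity (\sum_(r : {ffun 'I_u -> 'I_L.+1} |
      ((\sum_(i < u) (r i : nat))%N == (l - r1)%N) && [forall i, 0 < r i]%N)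
    \sum_(j1 < n | (0 < j1)%N) ('C(l - 1, r1 - 1) * b j1 ^_ r1)%:R / j1%:R *
   ((binprod (l - r1) (fun i => (r i : nat)))%:R *
   \sum_(j : {ffun 'I_u -> 'I_n} | [forall i, 0 < j i]%N)
     (\prod_(i < u) b (j i) ^_ (r i))%:R / (\prod_(i < u) (j i : nat))%:R
       * f (N - j1 - \sum_(i < u) (j i : nat)))); last first.
  rewrite exchange_big; by apply: eq_bigr => j1 _; rewrite -mulr_sumr.
rewrite [RHS]big_mkcond; apply: eq_bigr => r _.
rewrite (forall_fcons (fun r : 'I_L.+1 => (0 < r)%N)) r0 big_ord_recl fcons0.
under eq_bigr => i _ do rewrite fconsS.
rewrite -(eqn_add2l r1 _ (l - r1)%N) subnKC //; case: ifP => // _.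
rewrite (@binprod_fcons _ _ _ (fun i : 'I_L.+1 => i : nat)) natrM.
rewrite big_mkcond sum_fcons mulr_sumr [RHS]big_mkcond; apply: eq_bigr => j1 _.
case: ifP => j10; last first.
  apply/eqP; rewrite mulf_eq0; apply/orP; right; apply/eqP; apply: big1 => j _.
  by rewrite (forall_fcons (fun r : 'I_n => (0 < r)%N)) j10.
rewrite !mulr_sumr [RHS]big_mkcond; apply: eq_bigr => j _.
rewrite (forall_fcons (fun r : 'I_n => (0 < r)%N)) j10 /=; case: ifP => // _; last first.
  by rewrite mulr0.
rewrite !big_ord_recl !fcons0.
have -> : (\prod_(i < u) b (fcons j1 j (lift ord0 i)) ^_ fcons r1 r (lift ord0 i) =
           \prod_(i < u) b (j i) ^_ r i)%N by apply: eq_bigr => i _; rewrite !fconsS.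
have -> : (\prod_(i < u) fcons j1 j (lift ord0 i) = \prod_(i < u) j i)%N.
  by apply: eq_bigr => i _; rewrite fconsS.
have -> : (\sum_(i < u) fcons j1 j (lift ord0 i) = \sum_(i < u) j i)%N.
  by apply: eq_bigr => i _; rewrite fconsS.
by rewrite subnDA !natrM invfM; ring.
Qed.
(** The sum starts at $u=0$, which contributes only for $l=0$; this makes [f] the initial value of
    the recursion. *)
Definition comp_tot l N : F := \sum_(u < L.+1) th ^+ u * comp_sum u l N.

Lemma comp_tot0 N : comp_tot 0 N = f N.
Proof.
rewrite /comp_tot big_ord_recl comp_sum00 mul1r big1 ?addr0 // => u _.
by rewrite comp_sum_gt ?mulr0.
Qed.

Lemma sum_ord_shift (H : nat -> F) M K : (M <= K)%N -> (forall j, (M <= j)%N -> H j = 0) ->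
  \sum_(j < K | (0 < j)%N) H j = \sum_(j < M) H j.+1.
Proof.
case: K => [|K] MK H0; first by move: MK; rewrite leqn0 => /eqP ->; rewrite !big_ord0.
rewrite big_mkcond big_ord_recl /= add0r.
case: M MK H0 => [|M] MK H0.
  by rewrite big_ord0 big1 // => j _; rewrite H0.
rewrite [RHS]big_ord_recr /= H0 // addr0 (@big_ord_widen _ _ _ M K (fun j => H j.+1)) //.
rewrite [RHS]big_mkcond; apply: eq_bigr => j _ /=.
by case: ltnP => // Mj; rewrite H0.
Qed.

(** Peeling off $r_1=i+1$ and $j_1$ gives the recursion of [fmomS]: the factor $\binom{l}{r_1-1}$
    becomes $\binom{l}{i}$. *)
Lemma comp_totS l N : (l < L)%N -> (N <= n)%N -> comp_tot l.+1 N =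
  \sum_(j < N) th / j.+1%:R * \sum_(i < l.+1)
     ('C(l, i) * b j.+1 ^_ i.+1)%:R * comp_tot (l - i)%N (N - j.+1)%N.
Proof.
move=> lL Nn; rewrite {1}/comp_tot big_ord_recl comp_sum0 mulr0 add0r /=.
have totE i M : comp_tot (l - i)%N M = \sum_(u < L) th ^+ u * comp_sum u (l - i)%N M.
  rewrite /comp_tot big_ord_recr /= comp_sum_gt ?mulr0 ?addr0 //.
  by apply: leq_ltn_trans lL; rewrite leq_subr.
transitivity (\sum_(u < L) \sum_(j < N) \sum_(i < l.+1)
   th / j.+1%:R * (('C(l, i) * b j.+1 ^_ i.+1)%:R * (th ^+ u * comp_sum u (l - i)%N (N - j.+1)%N))).
  apply: eq_bigr => u _; rewrite comp_sumS exchange_big /=.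
  rewrite (sum_ord_shift (H := fun j => \sum_(r < L.+1 | (0 < r <= l.+1)%N)
    ('C(l.+1 - 1, r - 1) * b j ^_ r)%:R / j%:R * comp_sum u (l.+1 - r)%N (N - j)%N) Nn); last first.
    move=> j; rewrite -subn_eq0 => /eqP ->; apply: big1 => r _.
    by rewrite comp_sum_N0 mulr0.
  rewrite mulr_sumr; apply: eq_bigr => j _.
  rewrite big_mkcond big_ord_recl /= add0r (big_ord_widen L (fun i => th / j.+1%:R *
     (('C(l, i) * b j.+1 ^_ i.+1)%:R * (th ^+ u * comp_sum u (l - i)%N (N - j.+1)%N)))) //.
  rewrite mulr_sumr [RHS]big_mkcond; apply: eq_bigr => i _ /=.
  case: ifP => _; last by rewrite mulr0.
  by rewrite !subSS !subn0 exprS; ring.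
rewrite exchange_big; apply: eq_bigr => j _; rewrite exchange_big /= mulr_sumr.
by apply: eq_bigr => i _; rewrite totE !mulr_sumr.
Qed.

End CompositionSums.

(** * Asymptotics *)

Local Open Scope classical_set_scope.
Local Open Scope ring_scope.

(** * Inequalities for logarithms, exponentials and harmonic sums *)

Section Elementary.
Variable R : realType.
Implicit Types (x t : R) (n : nat).

Lemma ln_le_subr1 x : 0 < x -> ln x <= x - 1.
Proof. by move=> x0; have := @le_ln1Dx R (x - 1); rewrite subrKC => -> //; lra. Qed.

Lemma ln_ge_1subV x : 0 < x -> 1 - x^-1 <= ln x.
Proof.
move=> x0; have := @ln_le_subr1 x^-1; rewrite invr_gt0 => /(_ x0).
rewrite lnV ?posrE //; lra.
Qed.

Lemma norm_expRB1 t : `|expR t - 1| <= `|t| * expR `|t|.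
Proof.
have [t0|t0] := leP 0 t.
  rewrite [`|t|]ger0_norm // ger0_norm; last by rewrite subr_ge0 -expR0 ler_expR.
  have := expR_ge1Dx (- t); rewrite expRN => H.
  have e0 := expR_gt0 t; have : (1 - t) * expR t <= (expR t)^-1 * expR t by rewrite ler_pM2r.
  rewrite mulVf ?gt_eqF //; lra.
rewrite [`|t|]ltr0_norm // distrC ger0_norm; last by rewrite subr_ge0 -expR0 ler_expR ltW.
have := expR_ge1Dx t; have := expR_ge1Dx (- t); nra.
Qed.

Definition harm n : R := \sum_(j < n) j.+1%:R^-1.

Lemma harm_ge0 n : 0 <= harm n.
Proof. by apply: sumr_ge0 => j _; rewrite invr_ge0. Qed.

Lemma harm_le m n : (m <= n)%N -> harm m <= harm n.
Proof.
move=> mn; rewrite /harm (big_ord_widen n (fun j => j.+1%:R^-1)) // big_mkcond.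
by apply: ler_sum => j _; case: ifP => // _; rewrite invr_ge0.
Qed.

(** Induction with $1/(n+1)\le 2/(n+2)\le 2\ln((n+2)/(n+1))$. *)
Lemma harm_le_ln n : harm n <= 2 * ln (n.+1%:R).
Proof.
elim: n => [|n IHn]; first by rewrite /harm big_ord0 ln1 mulr0.
rewrite /harm big_ord_recr /= -/(harm n).
have n1 : 0 < n.+1%:R :> R by [].
have n2 : 0 < n.+2%:R :> R by [].
have := @ln_ge_1subV (n.+2%:R / n.+1%:R) (divr_gt0 n2 n1).
rewrite ln_div ?posrE // invf_div.
have -> : 1 - n.+1%:R / n.+2%:R = (n.+2%:R)^-1 :> R.
  by rewrite -{1}(@divff _ (n.+2%:R : R)) // -mulrBl -natrB // subSnn mul1r.
have : n.+1%:R^-1 <= 2 * n.+2%:R^-1 :> R.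
  rewrite ler_pdivlMr // mulrC ler_pdivrMr // -natrM ler_nat; lia.
move=> h1 h2; move: IHn h1 h2.
move: (harm n) (ln (n.+2%:R : R)) (ln (n.+1%:R : R)) (n.+1%:R^-1 : R) (n.+2%:R^-1 : R).
by move=> ? ? ? ? ?; lra.
Qed.

Lemma harm_pow_bound (e : R) : 0 < e ->
  (* With $x=\ln(n+1)$ and $E=e^{ex}\ge 1+ex$, both $1\le E$ and $x\le E/e$ hold, whence the
     constant $1+2/e$. *)
  exists2 C, 0 <= C & forall n, 1 + harm n <= C * expR (e * ln n.+1%:R).
Proof.
move=> e0; exists (1 + 2 / e); first by rewrite addr_ge0 // divr_ge0 // ltW.
move=> n; have := harm_le_ln n; set x := ln _ => hx.
have x0 : 0 <= x by apply: ln_ge0; rewrite ler1n.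
have := expR_ge1Dx (e * x); set E := expR _ => hE.
have -> : (1 + 2 / e) * E = E + 2 * (E / e) by field; rewrite gt_eqF.
have : x <= E / e by rewrite ler_pdivlMr //; lra.
have : 0 <= e * x by rewrite mulr_ge0 // ltW.
lra.
Qed.

End Elementary.

(** * Growth of $\theta^{(n)}/n!$ *)

Section RisingAsymptotics.
Variables (R : realType) (th : R).
Hypothesis th0 : 0 < th.

Definition rfrac n : R := rising th n / n`!%:R.

Lemma rfrac0 : rfrac 0 = 1.
Proof. by rewrite /rfrac /rising big_ord0 divr1. Qed.

Lemma rfracS n : rfrac n.+1 = rfrac n * ((th + n%:R) / n.+1%:R).
Proof.
rewrite /rfrac /rising big_ord_recr factS natrM /=; field.
by rewrite pnatr_eq0 -lt0n fact_gt0 nat1r pnatr_eq0.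
Qed.

Lemma rfrac_gt0 n : 0 < rfrac n.
Proof.
elim: n => [|n IHn]; first by rewrite rfrac0.
by rewrite rfracS mulr_gt0 // divr_gt0 // ltr_pwDl.
Qed.

Local Notation C := ((1 + th) ^+ 2).

(* Logarithm of [rfrac k / k^(th-1)], which converges (to [- ln Gamma(th)]). *)
Definition lnq k : R := ln (rfrac k) - (th - 1) * ln k%:R.

(** The increment is $\ln\frac{\theta+k}{k+1}-(\theta-1)\ln\frac{k+1}{k}$, where the terms of order
    $1/k$ cancel. The bound is written as a difference so that it telescopes in [lnq_diff]. *)
Lemma lnq_step k : (0 < k)%N -> `|lnq k.+1 - lnq k| <= C * (k%:R^-1 - k.+1%:R^-1).
Proof.
move=> k0; have tp := th0; have kp : 0 < k%:R :> R by rewrite ltr0n.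
have k1 : 0 < k.+1%:R :> R by [].
have kt : 0 < th + k%:R by rewrite addr_gt0.
rewrite /lnq rfracS lnM ?posrE ?rfrac_gt0 ?divr_gt0 //.
have kk : 0 < (th + k%:R) / k.+1%:R by rewrite divr_gt0.
have kk' : 0 < k.+1%:R / k%:R :> R by rewrite divr_gt0.
have := ln_le_subr1 kk; have := ln_ge_1subV kk.
have := ln_le_subr1 kk'; have := ln_ge_1subV kk'.
rewrite [ln (k.+1%:R / _)]ln_div ?posrE // !invf_div.
set a := ln k.+1%:R; set b := ln k%:R; set c := ln (_ / _).
have -> : ln (rfrac k) + c - (th - 1) * a - (ln (rfrac k) - (th - 1) * b) = c - (th - 1) * (a - b) by ring.
move: (a - b) => {a b}d; rewrite -[k.+1]addn1 natrD in k1 kk kk' *.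
move: (k%:R) kp kt k1 kk kk' => K kp kt k1 kk kk'.
have -> : 1 - K / (K + 1) = (K + 1)^-1 by field; rewrite gt_eqF.
have -> : (K + 1) / K - 1 = K^-1 by field; rewrite gt_eqF.
have -> : (th + K) / (K + 1) - 1 = (th - 1) / (K + 1) by field; rewrite gt_eqF.
have -> : 1 - (K + 1) / (th + K) = (th - 1) / (th + K) by field; rewrite gt_eqF.
have -> : C * (K^-1 - (K + 1)^-1) = C / (K * (K + 1)) by field; rewrite !gt_eqF.
move=> d1 d2 c1 c2.
(* The sign of $\theta-1$ decides which bound on [d] bounds $(\theta-1)d$ from above. *)
have [t1|t1] := leP 1 th.
  have e1 : (th - 1) / (K + 1) <= (th - 1) * d by rewrite ler_wpM2l //; lra.
  have e2 : (th - 1) * d <= (th - 1) / K by rewrite ler_wpM2l //; lra.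
  have e3 : (th - 1) / K - (th - 1) / (th + K) <= C / (K * (K + 1)).
    have -> : (th - 1) / K - (th - 1) / (th + K) = (th - 1) * th / (K * (th + K)).
      by field; rewrite !gt_eqF.
    apply: ler_pM; [nra | by rewrite invr_ge0 mulr_ge0 // ltW | nra |].
    by rewrite lef_pV2 ?posrE ?mulr_gt0 // ler_pM2l //; lra.
  rewrite ler_norml; apply/andP; split; first lra.
  have : 0 <= C / (K * (K + 1)) by rewrite divr_ge0 ?sqr_ge0 // mulr_ge0 // ltW.
  lra.
have e1 : (1 - th) / (K + 1) <= (1 - th) * d by rewrite ler_wpM2l //; lra.
have e2 : (1 - th) * d <= (1 - th) / K by rewrite ler_wpM2l //; lra.
have e3 : (1 - th) / (th + K) - (1 - th) / (K + 1) <= C / (K * (K + 1)).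
  have -> : (1 - th) / (th + K) - (1 - th) / (K + 1) = (1 - th) ^+ 2 / ((th + K) * (K + 1)).
    by field; rewrite !gt_eqF.
  apply: ler_pM; [nra | by rewrite invr_ge0 mulr_ge0 // ltW | nra |].
  by rewrite lef_pV2 ?posrE ?mulr_gt0 // ler_pM2r //; lra.
have e4 : (1 - th) / K - (1 - th) / (K + 1) <= C / (K * (K + 1)).
  have -> : (1 - th) / K - (1 - th) / (K + 1) = (1 - th) / (K * (K + 1)).
    by field; rewrite !gt_eqF.
  by rewrite ler_pM2r ?invr_gt0 ?mulr_gt0 //; nra.
have nE x : (th - 1) / x = - ((1 - th) / x) by ring.
rewrite !nE in c1 c2.
rewrite ler_norml; apply/andP; split; lra.
Qed.

Lemma lnq_diff k n : (0 < k <= n)%N -> `|lnq n - lnq k| <= C * (k%:R^-1 - n%:R^-1).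
Proof.
case/andP=> k0; elim: n => [|n IHn]; first by rewrite leqn0 => /eqP k0'; rewrite k0' in k0.
rewrite leq_eqVlt ltnS => /predU1P[->|kn]; first by rewrite !subrr normr0 mulr0.
have -> : lnq n.+1 - lnq k = (lnq n.+1 - lnq n) + (lnq n - lnq k) by ring.
apply: le_trans (ler_normD _ _) _.
apply: le_trans (lerD (lnq_step (leq_trans k0 kn)) (IHn kn)) _.
by rewrite -mulrDr [X in _ * X <= _]addrC addrA subrK.
Qed.

Lemma lnq_diff_le k n : (0 < k <= n)%N -> `|lnq k - lnq n| <= C / k%:R.
Proof.
move=> kn; rewrite distrC; apply: le_trans (lnq_diff kn) _; rewrite ler_wpM2l ?sqr_ge0 //.
by rewrite gerBl invr_ge0.
Qed.

Lemma rfrac_ratio k n : (0 < k <= n)%N ->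
  rfrac k / rfrac n = expR (lnq k - lnq n) * (k%:R / n%:R) `^ (th - 1).
Proof.
case/andP=> k0 kn; have n0 := leq_trans k0 kn.
have kp : 0 < k%:R :> R by rewrite ltr0n.
have np : 0 < n%:R :> R by rewrite ltr0n.
rewrite /powR gt_eqF ?divr_gt0 // -expRD ln_div ?posrE // /lnq.
have -> : ln (rfrac k) - (th - 1) * ln k%:R - (ln (rfrac n) - (th - 1) * ln n%:R) +
  (th - 1) * (ln k%:R - ln n%:R) = ln (rfrac k) - ln (rfrac n) by ring.
have a := rfrac_gt0 k; have b := rfrac_gt0 n; have c := divr_gt0 a b.
by rewrite -ln_div ?posrE // lnK ?posrE.
Qed.

Lemma rfrac_ratio_le k n : (0 < k <= n)%N ->
  rfrac k / rfrac n <= expR C * (k%:R / n%:R) `^ (th - 1).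
Proof.
move=> kn; rewrite rfrac_ratio // ler_wpM2r ?powR_ge0 // ler_expR.
apply: le_trans (ler_norm _) _; apply: le_trans (lnq_diff_le kn) _.
case/andP: kn => k0 _; rewrite ler_pdivrMr ?ltr0n //.
by rewrite ler_peMr ?sqr_ge0 // ler1n.
Qed.

(** The case $k=1$ of [rfrac_ratio_le], where [rfrac th 1] is $\theta$. *)
Lemma rfracV_le n : (0 < n)%N -> (rfrac n)^-1 <= expR C / th * n%:R `^ (1 - th).
Proof.
move=> n0; have := @rfrac_ratio_le 1 n n0.
rewrite rfracS rfrac0 mul1r addr0 divr1.
have -> : 1%:R / n%:R = n%:R^-1 :> R by rewrite mul1r.
rewrite -[n%:R^-1]powR_inv1 ?ler0n // -powRrM mulN1r opprB => H.
by rewrite -(ler_pM2l th0) mulrA mulrCA divff ?gt_eqF // mulr1.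
Qed.

End RisingAsymptotics.

(** * Stability of the recursion under perturbed initial values *)

Section ConvolutionBound.
Variables (R : realType) (th : R).
Hypothesis th0 : 0 < th.

(** With $k=N-j$, partial fractions give $\frac1{j(k+1)}=\frac1{N+1}(\frac1j+\frac1{k+1})$.
    Monotonicity replaces $g(k)$ by $g(N)$, and reversing the order of summation shows that both
    remaining sums are harmonic. *)
Lemma conv_harm_le (g : nat -> R) N : (forall j, 0 <= g j) -> {homo g : i j / (i <= j)%N >-> i <= j} ->
  \sum_(j < N) j.+1%:R^-1 * (g (N - j.+1)%N / (N - j.+1).+1%:R) <= 2 * harm R N * (g N / N.+1%:R).
Proof.
move=> g0 gh.
have H : harm R N = \sum_(j < N) (N - j.+1).+1%:R^-1.
  by rewrite /harm (reindex_inj rev_ord_inj).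
have -> : 2 * harm R N * (g N / N.+1%:R) =
    \sum_(j < N) (j.+1%:R^-1 + (N - j.+1).+1%:R^-1) * (g N / N.+1%:R).
  by rewrite -mulr_suml big_split /= -H /harm; congr (_ * _); ring.
apply: ler_sum => j _.
have -> : j.+1%:R^-1 * (g (N - j.+1)%N / (N - j.+1).+1%:R) =
   (j.+1%:R^-1 + (N - j.+1).+1%:R^-1) * (g (N - j.+1)%N / N.+1%:R).
  have -> : N.+1%:R = j.+1%:R + (N - j.+1).+1%:R :> R.
    by rewrite -natrD addnS subnKC.
  have : 0 < j.+1%:R :> R by []; have : 0 < (N - j.+1).+1%:R :> R by [].
  move: (j.+1%:R) ((N - j.+1).+1%:R) => x y y0 x0.
  by field; rewrite !gt_eqF ?addr_gt0.
rewrite ler_wpM2l ?addr_ge0 ?invr_ge0 // ler_wpM2r ?invr_ge0 //.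
by apply: gh; rewrite leq_subr.
Qed.

Lemma ffact_le_expn b m k : (b <= m)%N -> (b ^_ k <= m ^ k)%N.
Proof.
move=> bm; elim: k => [|k IHk] //; rewrite ffactnSr expnSr leq_mul //.
by apply: leq_trans bm; rewrite leq_subr.
Qed.

(** Induction on [L]: one use of the recursion costs a constant and, by [conv_harm_le], one factor
    [1 + harm R n]. The constant [K] depends only on [th], [m] and [L], hence is uniform in [n] and
    [b]. *)
Lemma conv_bound m L : exists2 K : R, 0 <= K &
  forall (b : nat -> nat) (D : nat -> nat -> R) (A : R) (g : nat -> R) n,
  (forall j, (b j <= m)%N) -> 0 <= A -> (forall j, 0 <= g j) ->
  {homo g : i j / (i <= j)%N >-> i <= j} ->
  (forall N, (N <= n)%N -> `|D 0%N N| <= A * (g N / N.+1%:R)) ->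
  (forall l N, (l < L)%N -> (N <= n)%N -> D l.+1 N =
     \sum_(j < N) th / j.+1%:R * \sum_(i < l.+1)
       ('C(l, i) * b j.+1 ^_ i.+1)%:R * D (l - i)%N (N - j.+1)%N) ->
  forall l N, (l <= L)%N -> (N <= n)%N ->
    `|D l N| <= A * K * (1 + harm R n) ^+ L * (g N / N.+1%:R).
Proof.
elim: L => [|L [K K0 IH]].
  exists 1 => // b D A g n _ _ _ _ HD _ l N; rewrite leqn0 => /eqP -> Nn.
  by rewrite mulr1 expr0 mulr1 HD.
pose B : R := \sum_(i < L.+1) ('C(L, i) * m ^ i.+1)%:R.
have B0 : 0 <= B by apply: sumr_ge0.
have KB0 : 0 <= 2 * th * B * K by rewrite !mulr_ge0 // ltW.
(* The first summand serves the orders up to [L], the second the new order [L.+1]. *)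
exists (K + 2 * th * B * K); first by rewrite addr_ge0.
move=> b D A g n bm A0 g0 gh HD0 HD l N.
have HD' l' N' : (l' < L)%N -> (N' <= n)%N -> D l'.+1 N' =
     \sum_(j < N') th / j.+1%:R * \sum_(i < l'.+1)
       ('C(l', i) * b j.+1 ^_ i.+1)%:R * D (l' - i)%N (N' - j.+1)%N.
  by move=> lL; apply: HD; apply: ltnW.
have {}IH := IH b D A g n bm A0 g0 gh HD0 HD'.
set Q := 1 + harm R n; have Q1 : 1 <= Q by rewrite lerDl harm_ge0.
have Q0 : 0 <= Q by apply: le_trans Q1.
have w0 k : 0 <= g k / k.+1%:R by rewrite divr_ge0.
rewrite leq_eqVlt => /predU1P[-> | lL] Nn; last first.
  apply: le_trans (IH _ _ lL Nn) _; rewrite ler_wpM2r // -/Q.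
  apply: ler_pM; rewrite ?mulr_ge0 ?exprn_ge0 //; first by rewrite ler_wpM2l // lerDl.
  by rewrite exprS ler_peMl // exprn_ge0.
rewrite HD //; apply: le_trans (ler_norm_sum _ _ _) _.
apply: (@le_trans _ _ (\sum_(j < N) th * B * (A * K * Q ^+ L) *
           (j.+1%:R^-1 * (g (N - j.+1)%N / (N - j.+1).+1%:R)))).
  apply: ler_sum => j _; rewrite normrM ger0_norm; last by rewrite divr_ge0 // ltW.
  rewrite [X in _ <= X](_ : _ = th / j.+1%:R *
    (B * (A * K * Q ^+ L * (g (N - j.+1)%N / (N - j.+1).+1%:R)))); last by ring.
  rewrite ler_wpM2l //; first by rewrite divr_ge0 // ltW.
  rewrite /B mulr_suml; apply: le_trans (ler_norm_sum _ _ _) _.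
  apply: ler_sum => i _; rewrite normrM ger0_norm // ler_pM //.
    by rewrite ler_nat leq_mul2l ffact_le_expn ?orbT.
  by apply: IH; rewrite ?leq_subr // (leq_trans _ Nn) // leq_subr.
rewrite -mulr_sumr.
have c0 : 0 <= th * B * (A * K * Q ^+ L) by rewrite !mulr_ge0 ?exprn_ge0 // ltW.
apply: le_trans (ler_wpM2l c0 (conv_harm_le N g0 gh)) _.
rewrite -/Q [X in X <= _]mulrA ler_wpM2r //.
have hQ : harm R N <= Q.
  by apply: le_trans (harm_le R Nn) _; rewrite /Q lerDr.
apply: (@le_trans _ _ (th * B * (A * K * Q ^+ L) * (2 * Q))).
  by rewrite ler_wpM2l // ler_wpM2l.
rewrite exprS; have : 0 <= A * K * (Q * Q ^+ L) by rewrite !mulr_ge0 ?exprn_ge0.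
move: (Q ^+ L) => q; nra.
Qed.

End ConvolutionBound.

(* The value at [0] is [0], even for [th = 1], because the sums in [Ups] omit
   [j_1 + ... + j_u = n]. *)
Definition beta_weight (R : realType) (th : R) (n k : nat) : R :=
  if k == 0%N then 0 else powR (k%:R / n%:R) (th - 1).

(** Terms with some $r_i>m$ vanish because $b_j\le m$ kills the falling factorial, and those with
    $\sum j_i\ge n$ vanish because [beta_weight] is 0 at 0. *)
Lemma Ups_comp_tot (R : realType) (th : R) (a : nat -> nat -> int) n l m : (0 < l)%N ->
  Ups th a n l m = comp_tot th (bcut a n m) (beta_weight th n) n l l n.
Proof.
move=> l0; rewrite /Ups /comp_tot big_ord_recl.
have -> : comp_sum (bcut a n m) (beta_weight th n) n l 0 l n = 0.
  by case: l l0 => // l _; rewrite comp_sum0.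
rewrite mulr0 add0r big_add1 big_mkord; apply: eq_bigr => u _; congr (_ * _).
rewrite /comp_sum big_mkcond [RHS]big_mkcond; apply: eq_bigr => r _ /=.
case: (_ == l) => //=.
have [r0|] := boolP [forall i, (0 < r i)%N]; last first.
  by case: ifP => // /forallP H /forallP[] i; have /andP[] := H i.
have [rm|] := boolP [forall i, (r i <= m)%N]; last first.
  rewrite negb_forall => /existsP[i]; rewrite -ltnNge => ri.
  case: ifP => [/forallP /(_ i) /andP[_]|_]; first by rewrite leqNgt ri.
  rewrite big1 ?mulr0 // => j _.
  rewrite (bigD1 i) //= ffact_small ?mul0n ?mul0r //.
  by apply: leq_ltn_trans ri; rewrite geq_minr.
have -> : [forall i, (0 < r i)%N && (r i <= m)%N].
  by apply/forallP => i; rewrite (forallP r0 i) (forallP rm i).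
congr (_ * _); rewrite big_mkcond [RHS]big_mkcond; apply: eq_bigr => j _ /=.
case: [forall i, _] => //=; case: ltnP => jn; rewrite /beta_weight; last first.
  by move: (jn); rewrite -subn_eq0 => ->; rewrite mulr0.
rewrite -if_neg -lt0n subn_gt0 jn; congr (_ * powR _ _).
have n0 : n%:R != 0 :> R by rewrite pnatr_eq0 -lt0n (leq_ltn_trans _ jn).
by rewrite natrB ?(ltnW jn) // mulrBl divff.
Qed.

(** * Comparison of the factorial moments with $\Upsilon_n(l,m)$ *)

Section MomentComparison.
Variables (R : realType) (th : R).
Hypothesis th0 : 0 < th.

(* The error at [k] is [O(n^(1-th) (k+1)^(err_expo-1))] with [0 <= err_expo < th];
   nonnegativity keeps this shape stable under [conv_bound]. *)
Definition err_gap := Num.min th 1.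
Definition err_expo := th - err_gap.

Let de0 : 0 < err_gap. Proof. by rewrite lt_min th0 ltr01. Qed.
Let de1 : err_gap <= 1. Proof. by rewrite ge_min lexx orbT. Qed.
Let be0 : 0 <= err_expo. Proof. by rewrite subr_ge0 ge_min lexx. Qed.

(** Since [err_gap] is at most 1, $k^\theta$ is at most $(k+1)$ to the power [err_expo] plus 1; the
    factor 4 comes from using $1/k\le 2/(k+1)$ twice. *)
Lemma powR_div_le k n : (0 < k <= n)%N ->
  (k%:R / n%:R) `^ (th - 1) / k%:R <= 4 * (n%:R `^ (1 - th) * (k.+1%:R `^ err_expo / k.+1%:R)).
Proof.
case/andP=> k0 kn; have n0 := leq_trans k0 kn.
have kp : 0 < k%:R :> R by rewrite ltr0n.
have np : 0 < n%:R :> R by rewrite ltr0n.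
rewrite powRM ?invr_ge0 ?ler0n // -[n%:R^-1]powR_inv1 ?ler0n // -powRrM mulN1r opprB.
rewrite [4 * _]mulrCA [_ `^ _ * _ `^ _]mulrC -mulrA ler_wpM2l ?powR_ge0 //.
have -> : k%:R `^ (th - 1) = k%:R `^ th / k%:R.
  by rewrite powRD ?(gt_eqF kp) ?implybT // powR_inv1 ?ltW.
have h1 : k%:R `^ th <= k.+1%:R `^ err_expo * k.+1%:R.
  apply: (@le_trans _ _ (k.+1%:R `^ th)).
    by apply: ge0_ler_powR; rewrite ?nnegrE ?ler0n ?ler_nat ?(ltW th0).
  have -> : th = err_expo + err_gap by rewrite /err_expo subrK.
  rewrite powRD ?pnatr_eq0 ?implybT // ler_wpM2l ?powR_ge0 //.
  rewrite -[X in _ <= X]powRr1 // ler_powR // ler1n //.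
have h2 : k.+1%:R / k%:R <= 2 :> R by rewrite ler_pdivrMr // -natrM ler_nat; lia.
have h3 : k%:R^-1 <= 2 * k.+1%:R^-1 :> R by rewrite ler_pdivlMr // mulrC.
have p0 : 0 <= k.+1%:R `^ err_expo by rewrite powR_ge0.
apply: (@le_trans _ _ (k.+1%:R `^ err_expo * k.+1%:R * (2 * k.+1%:R^-1) * (2 * k.+1%:R^-1))).
  by rewrite !ler_pM ?mulr_ge0 ?invr_ge0 ?powR_ge0 // ltW.
rewrite le_eqVlt; apply/orP; left; apply/eqP.
by move: (k.+1%:R `^ err_expo) => p; field; rewrite nat1r pnatr_eq0.
Qed.

Lemma rfrac_beta_weight : exists2 K : R, 0 <= K & forall n k, (0 < n)%N -> (k <= n)%N ->
  `|rfrac th k / rfrac th n - beta_weight th n k| <=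
    K * n%:R `^ (1 - th) * (k.+1%:R `^ err_expo / k.+1%:R).
Proof.
set C := (1 + th) ^+ 2; have C0 : 0 <= C by rewrite sqr_ge0.
have E0 : 0 <= expR C by apply: expR_ge0.
have ET0 : 0 <= expR C / th by rewrite divr_ge0 // ltW.
(* The first summand covers $k>0$, where the ratio is the weight times $e^{O(1/k)}$; the second
   covers $k=0$, where the weight is 0 and [rfracV_le] applies. *)
exists (4 * C * expR C + expR C / th); first by rewrite addr_ge0 // mulr_ge0 // mulr_ge0.
move=> n k n0 kn; have N0 := powR_ge0 (n%:R : R) (1 - th).
rewrite /beta_weight; case: eqP => [->|/eqP]; last rewrite -lt0n => k0.
  rewrite rfrac0 mul1r subr0 powR1 divr1 mulr1 ger0_norm; last by rewrite invr_ge0 ltW // rfrac_gt0.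
  apply: le_trans (rfracV_le th0 n0) _; by rewrite ler_wpM2r // lerDr mulr_ge0 // mulr_ge0.
have kn' : (0 < k <= n)%N by rewrite k0.
have kp : 0 < k%:R :> R by rewrite ltr0n.
rewrite (rfrac_ratio th0 kn') -[X in _ - X]mul1r -mulrBl normrM [X in _ * X]ger0_norm ?powR_ge0 //.
have hd := lnq_diff_le th0 kn'.
have hd' : `|lnq th k - lnq th n| <= C.
  by apply: le_trans hd _; rewrite ler_pdivrMr // ler_peMr // ler1n.
have h1 : `|expR (lnq th k - lnq th n) - 1| <= C / k%:R * expR C.
  apply: le_trans (norm_expRB1 _) _; apply: ler_pM => //.
  by rewrite ler_expR.
have p0 := powR_ge0 (k%:R / n%:R : R) (th - 1).
apply: le_trans (ler_wpM2r p0 h1) _.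
have := powR_div_le kn'; set w := _ / k.+1%:R => h2.
have w0 : 0 <= w by rewrite divr_ge0 ?powR_ge0.
have -> : C / k%:R * expR C * (k%:R / n%:R) `^ (th - 1) =
  C * expR C * ((k%:R / n%:R) `^ (th - 1) / k%:R) by ring.
have c0 : 0 <= C * expR C by rewrite mulr_ge0.
apply: le_trans (ler_wpM2l c0 h2) _.
have -> : C * expR C * (4 * (n%:R `^ (1 - th) * w)) = 4 * C * expR C * (n%:R `^ (1 - th) * w) by ring.
by rewrite -[X in _ <= X]mulrA ler_wpM2r ?mulr_ge0 // lerDl.
Qed.

Lemma powR_neg_cvg0 (e : R) : 0 < e -> (fun n : nat => n.+1%:R `^ (- e)) @ \oo --> (0 : R).
Proof.
move=> e0; apply/cvgr0Pnorm_lt => eps eps0.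
near=> n; rewrite ger0_norm ?powR_ge0 // powRN invf_plt ?posrE ?powR_gt0 //.
have x0 : 0 <= eps^-1 `^ e^-1 by apply: powR_ge0.
have -> : eps^-1 = (eps^-1 `^ e^-1) `^ e.
  by rewrite -powRrM mulVf ?gt_eqF // powRr1 // invr_ge0 ltW.
apply: gt0_ltr_powR; rewrite ?nnegrE //.
rewrite -natr1; apply: (@le_lt_trans _ _ n%:R); last by rewrite ltrDl.
by near: n; apply: nbhs_infty_ger.
Unshelve. all: by end_near. Qed.

(** The recursion is linear, so the difference satisfies it with the initial error of
    [rfrac_beta_weight]. By [conv_bound] it is at most a power of $n$ with exponent minus [err_gap],
    up to [l] harmonic factors and a constant. *)
Lemma moment_error_cvg0 (b : nat -> nat -> nat) m l : (forall n j, (b n j <= m)%N) ->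
  (fun n => fmom th (b n) n l / rfrac th n -
     comp_tot th (b n) (beta_weight th n) n l l n) @ \oo --> (0 : R).
Proof.
move=> bm; have [K0 K00 HK0] := rfrac_beta_weight.
have [K K0' HK] := conv_bound th0 m l.
(* Each of the [l] harmonic factors costs $n^e$, and [err_gap] exceeds $le$ by exactly $e$. *)
pose e := err_gap / l.+1%:R; have e0 : 0 < e by rewrite divr_gt0.
have [C1 C10 HC1] := harm_pow_bound e0.
pose M := K0 * K * C1 ^+ l * 2 `^ th.
have key n : (0 < n)%N -> `|fmom th (b n) n l / rfrac th n -
     comp_tot th (b n) (beta_weight th n) n l l n| <= M * n.+1%:R `^ (- e).
  move=> n0; pose D l' N := fmom th (b n) N l' / rfrac th n -
     comp_tot th (b n) (beta_weight th n) n l l' N.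
  have np : 0 < n%:R :> R by rewrite ltr0n.
  have n1 : n.+1%:R != 0 :> R by rewrite pnatr_eq0.
  have := HK (b n) D (K0 * n%:R `^ (1 - th)) (fun k => k.+1%:R `^ err_expo) n (bm n).
  rewrite mulr_ge0 ?powR_ge0 // => /(_ isT (fun _ => powR_ge0 _ _)) H.
  have {}H := H _ _ _ l n (leqnn l) (leqnn n).
  apply: le_trans (H _ _ _) _ => {H}.
  - by move=> i j ij; apply: ge0_ler_powR; rewrite ?nnegrE ?ler0n ?ler_nat.
  - by move=> N Nn; rewrite /D fmom0 comp_tot0 -/(rising th N) -/(rfrac th N); apply: HK0.
  - move=> l' N ll Nn; rewrite /D fmomS (comp_totS th (b n) (f := beta_weight th n) (erefl _) ll Nn).
    rewrite mulr_suml -sumrB; apply: eq_bigr => j _.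
    rewrite -mulrA -mulrBr; congr (_ * _); rewrite mulr_suml -sumrB; apply: eq_bigr => i _.
    by rewrite -mulrA -mulrBr.
  have hQ : (1 + harm R n) ^+ l <= C1 ^+ l * n.+1%:R `^ (e * l%:R).
    have := HC1 n; have -> : expR (e * ln n.+1%:R) = n.+1%:R `^ e.
      by rewrite /powR (negbTE n1).
    rewrite (powRrM _ e) powR_mulrn ?powR_ge0 // -exprMn => h.
    by apply: lerXn2r; rewrite ?nnegrE ?addr_ge0 ?harm_ge0 ?mulr_ge0 ?powR_ge0.
  (* Passing from $n$ to $n+1$ costs $2^\theta$, because $n+1\le 2n$. *)
  have hn : n%:R `^ (1 - th) <= n.+1%:R * 2 `^ th * n.+1%:R `^ (- th).
    rewrite powRD ?(gt_eqF np) ?implybT // powRr1 ?ler0n // -mulrA.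
    apply: ler_pM; rewrite ?ler0n ?powR_ge0 ?ler_nat //.
    rewrite !powRN -[X in _ <= X]invrK invfM invrK lef_pV2 ?posrE ?powR_gt0 ?mulr_gt0 ?invr_gt0 ?powR_gt0 //.
    rewrite mulrC ler_pdivrMr ?powR_gt0 // -powRM ?ler0n //.
    apply: ge0_ler_powR; rewrite ?nnegrE ?mulr_ge0 ?ler0n ?(ltW th0) //.
    by rewrite -natrM ler_nat; lia.
  have -> : M * n.+1%:R `^ (- e) = K0 * (n.+1%:R * 2 `^ th * n.+1%:R `^ (- th)) * K *
     (C1 ^+ l * n.+1%:R `^ (e * l%:R)) * (n.+1%:R `^ err_expo / n.+1%:R).
    have -> : - e = - th + e * l%:R + err_expo.
      rewrite /err_expo /e; move: err_gap => d; rewrite -[l.+1]addn1 natrD; field.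
      by rewrite natr1 pnatr_eq0.
    rewrite !powRD ?n1 ?implybT // /M.
    by move: (_ `^ _) (_ `^ _) (_ `^ _) (_ `^ _) => p1 p2 p3 p4; field; rewrite nat1r.
  rewrite ler_wpM2r ?divr_ge0 ?powR_ge0 //.
  apply: ler_pM; rewrite ?mulr_ge0 ?powR_ge0 ?exprn_ge0 ?addr_ge0 ?harm_ge0 //.
  by rewrite ler_wpM2r // ler_wpM2l.
have hc := powR_neg_cvg0 e0.
have {}hc : (fun n : nat => M * n.+1%:R `^ (- e)) @ \oo --> (0 : R).
  by rewrite -(mulr0 M); apply: cvgMl_tmp.
apply/cvgr0Pnorm_lt => eps eps0.
move/cvgr0Pnorm_lt : hc => /(_ _ eps0) hc.
near=> n; apply: le_lt_trans (key n _) _; first by near: n; exists 1%N.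
by apply: le_lt_trans (ler_norm _) _; near: n.
Unshelve. all: by end_near. Qed.

End MomentComparison.

(** * Expectations and the cut statistic *)

Section EwensExpectation.
Variables (R : realType) (th : R).
Hypothesis th0 : 0 < th.

Definition Eew n (g : {perm 'I_n} -> R) : R :=
  (\sum_(s : {perm 'I_n}) th ^+ wcyc s * g s) / rising th n.

Lemma rising_gt0 n : 0 < rising th n.
Proof. by apply: prodr_gt0 => i _; rewrite ltr_pwDl. Qed.

Lemma Eew_le n (g g' : {perm 'I_n} -> R) : (forall s, g s <= g' s) -> Eew g <= Eew g'.
Proof.
move=> gg; rewrite /Eew ler_wpM2r ?invr_ge0 ?(ltW (rising_gt0 n)) //.
by apply: ler_sum => s _; rewrite ler_wpM2l // exprn_ge0 // ltW.
Qed.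

Lemma Eew_ext n (g g' : {perm 'I_n} -> R) : (forall s, g s = g' s) -> Eew g = Eew g'.
Proof. by move=> gg; congr (_ / _); apply: eq_bigr => s _; rewrite gg. Qed.

Lemma EewD n (g g' : {perm 'I_n} -> R) : Eew (fun s => g s + g' s) = Eew g + Eew g'.
Proof.
by rewrite /Eew -mulrDl -big_split; congr (_ / _); apply: eq_bigr => s _; rewrite mulrDr.
Qed.

Lemma EewZ n (c : R) (g : {perm 'I_n} -> R) : Eew (fun s => c * g s) = c * Eew g.
Proof.
rewrite /Eew mulrA mulr_sumr; congr (_ / _); apply: eq_bigr => s _; exact: mulrCA.
Qed.

Lemma EewB n (g g' : {perm 'I_n} -> R) : Eew (fun s => g s - g' s) = Eew g - Eew g'.
Proof.
rewrite -mulN1r -EewZ -EewD; apply: Eew_ext => s; by rewrite mulN1r.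
Qed.

Lemma Eew_sum n (I : Type) (r : seq I) (P : pred I) (g : I -> {perm 'I_n} -> R) :
  Eew (fun s => \sum_(i <- r | P i) g i s) = \sum_(i <- r | P i) Eew (g i).
Proof.
rewrite /Eew -mulr_suml exchange_big; congr (_ / _).
by apply: eq_bigr => s _; rewrite mulr_sumr.
Qed.

Lemma Eew_norm_le n (g g' h : {perm 'I_n} -> R) :
  (forall s, `|g s - g' s| <= h s) -> `|Eew g - Eew g'| <= Eew h.
Proof.
move=> gh; rewrite -EewB ler_norml -mulN1r -EewZ; apply/andP; split; apply: Eew_le => s.
  by rewrite mulN1r; have := gh s; rewrite ler_norml => /andP[].
by have := gh s; rewrite ler_norml => /andP[].
Qed.

Lemma Eew_ge0 n (g : {perm 'I_n} -> R) : (forall s, 0 <= g s) -> 0 <= Eew g.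
Proof.
move=> g0; rewrite /Eew divr_ge0 ?(ltW (rising_gt0 n)) //.
by apply: sumr_ge0 => s _; rewrite mulr_ge0 // exprn_ge0 // ltW.
Qed.

Lemma Eew_ffact b n l :
  Eew (fun s : {perm 'I_n} => (cyc_sum b s ^_ l)%:R) = fmom th b n l / rfrac th n.
Proof.
by rewrite /fmom /rfrac invf_div mulrA divfK // pnatr_eq0 -lt0n fact_gt0.
Qed.

(** The zeroth factorial moment, which [fmom0] evaluates. *)
Lemma Eew1 n : Eew (fun s : {perm 'I_n} => 1) = 1.
Proof.
rewrite (@Eew_ext _ _ (fun s => (cyc_sum id s ^_ 0)%:R)) // Eew_ffact fmom0.
by rewrite -/(rising th n) -/(rfrac th n) divff // gt_eqF ?rfrac_gt0.
Qed.

Lemma ewensE n (A : pred {perm 'I_n}) : ewens th A = Eew (fun s => (A s)%:R).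
Proof.
rewrite /ewens /Eew big_mkcond; congr (_ / _); apply: eq_bigr => s _.
by case: (A s); rewrite ?mulr1 ?mulr0.
Qed.

End EwensExpectation.

(** * Bonferroni's inequalities *)

Lemma bin_alt_sum (R : comNzRingType) N L :
  \sum_(i < L.+1) (-1) ^+ i * 'C(N.+1, i)%:R = (-1) ^+ L * 'C(N, L)%:R :> R.
Proof.
elim: L => [|L IHL]; first by rewrite big_ord1 !bin0.
rewrite big_ord_recr /= IHL binS natrD exprS; move: ((-1) ^+ L) => e; ring.
Qed.

Lemma bonferroni (R : numDomainType) x k L :
  `|(x == k)%:R - \sum_(i < L.+1) (-1) ^+ i * ('C(k + i, k) * 'C(x, k + i))%:R| <=
  ('C(k + L.+1, k) * 'C(x, k + L.+1))%:R :> R.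
Proof.
(* Trinomial revision factors out $\binom xk$. For $x>k$ the alternating sum that remains is
   $\pm\binom{x-k-1}{L}$, which is at most $\binom{x-k}{L+1}$ by Pascal's rule. *)
have tri i : ('C(k + i, k) * 'C(x, k + i) = 'C(x, k) * 'C(x - k, i))%N.
  have [kix|xki] := leqP (k + i) x; last first.
    rewrite (bin_small xki) muln0; case: (leqP k x) => kx; last by rewrite (bin_small kx).
    by rewrite [X in (_ * X)%N]bin_small ?muln0 // ltn_subLR.
  have kx : (k <= x)%N by apply: leq_trans kix; rewrite leq_addr.
  have ix : (i <= x - k)%N by rewrite leq_subRL.
  have ki : (k <= k + i)%N by rewrite leq_addr.
  apply/eqP; rewrite -(eqn_pmul2r (fact_gt0 k)) -(eqn_pmul2r (fact_gt0 i)).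
  rewrite -(eqn_pmul2r (fact_gt0 (x - (k + i)))); apply/eqP.
  have e1 := bin_fact kix; have e2 := bin_fact ki; rewrite addKn in e2.
  have e3 := bin_fact kx; have e4 := bin_fact ix; rewrite -subnDA in e4.
  transitivity x`!.
    by rewrite -e1 -e2; ring.
  by rewrite -e3 -e4; ring.
under eq_bigr => i _ do rewrite tri natrM mulrCA.
rewrite -mulr_sumr tri; case: (ltngtP x k) => [xk|kx|->].
- by rewrite bin_small // !mul0r subr0 normr0 mul0n.
- have -> : (x - k = (x - k).-1.+1)%N by rewrite prednK // subn_gt0.
  rewrite bin_alt_sum sub0r normrN !normrM normrX normrN1 expr1n mul1r !ger0_norm // -natrM.
  by rewrite ler_nat leq_mul2l binS leq_addl orbT.
- rewrite subnn binn mul1r big_ord_recl bin0 expr0 mulr1 big1 ?addr0 ?subrr ?normr0 //.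
  by move=> i _; rewrite bin_small // mulr0.
Qed.

(** * Comparison of $h_n$ with its cut version *)

Section CycleSums.
Variables (a : nat -> nat -> int) (n : nat).
Implicit Types (s : {perm 'I_n}) (m : nat).

Lemma hn_cycles s : hn a s = \sum_(c in porbits s) a n #|c|.
Proof.
have cn (c : {set 'I_n}) : (#|c| < n.+1)%N.
  by rewrite ltnS; apply: leq_trans (max_card _) _; rewrite card_ord.
rewrite (partition_big (fun c : {set 'I_n} => inord #|c| : 'I_n.+1) xpredT) //=.
(* The class $j=0$ is empty, since no cycle has length 0. *)
rewrite big_ord_recl /= big_pred0 ?add0r.
  rewrite /hn big_add1 /= big_mkord; apply: eq_bigr => j _.
  rewrite /kcyc -sum1_card -natz natr_sum mulr_sumr; apply: eq_big => [c|c].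
    by rewrite inE -val_eqE /= inordK.
  by rewrite inE => /andP[_ /eqP ->]; rewrite mulr1.
move=> c; apply/negP => /andP[/imsetP[z _ ->]] /eqP/(congr1 val) /=.
by rewrite inordK // => /eqP; rewrite (negbTE (card_porbit_neq0 _ _)).
Qed.

(** The number of cycles of negative weight, written as a [cyc_sum] so that its mean is a first
    factorial moment. *)
Definition negc s : nat := cyc_sum (fun j => nat_of_bool (a n j <= -1)%R) s.

Lemma negc_eq0 s c : negc s = 0%N -> c \in porbits s -> 0 <= a n #|c|.
Proof.
move=> /eqP; rewrite /negc /cyc_sum sum_nat_eq0 => /forall_inP /[apply].
by rewrite eqb0; lia.
Qed.

Lemma hn_ge0 s : negc s = 0%N -> 0 <= hn a s.
Proof. by move=> N0; rewrite hn_cycles sumr_ge0 // => c; apply: negc_eq0. Qed.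

(** If the total stays below [m], so does each cut weight, and then no upper cut is active. *)
Lemma hn_cut s m : negc s = 0%N -> (cyc_sum (bcut a n m) s < m)%N ->
  hn a s = (cyc_sum (bcut a n m) s)%:Z.
Proof.
move=> N0 Xm; rewrite hn_cycles /cyc_sum -natz natr_sum; apply: eq_bigr => c cs.
have a0 := negc_eq0 N0 cs.
have : (bcut a n m #|c| < m)%N.
  by apply: leq_ltn_trans Xm; rewrite /cyc_sum (bigD1 c) //= leq_addr.
rewrite /bcut max_l //; case: (a n #|c|) a0 => // k _ /=; rewrite natz => km.
by congr Posz; lia.
Qed.

(** The indicators can differ only if [negc s] is at least 1 or $X\ge m$; Markov's bound $\mathbf
    1\{X\ge m\}\le X/m$ is applied pointwise. *)
Lemma hn_cut_eq (R : realFieldType) s m (k : nat) : (0 < m)%N ->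
  `|(hn a s == k)%:R - (cyc_sum (bcut a n m) s == k)%:R| <=
     (negc s)%:R + m%:R^-1 * (cyc_sum (bcut a n m) s)%:R :> R.
Proof.
move=> m0; set X := cyc_sum _ s.
have b1 (b1 b2 : bool) : `|b1%:R - b2%:R| <= 1 :> R.
  by case: b1; case: b2; rewrite ?subrr ?subr0 ?sub0r ?normrN ?normr0 ?normr1.
have mX : 0 <= m%:R^-1 * X%:R :> R by rewrite mulr_ge0 // invr_ge0.
have [N0|] := eqVneq (negc s) 0%N; last first.
  rewrite -lt0n => N0; apply: le_trans (b1 _ _) _.
  by apply: (@le_trans _ _ (negc s)%:R); rewrite ?ler1n // lerDl.
have [Xm|mX'] := ltnP X m; last first.
  apply: le_trans (b1 _ _) _; rewrite N0 add0r mulrC ler_pdivlMr ?ltr0n // mul1r.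
  by rewrite ler_nat.
rewrite (hn_cut N0 Xm) -/X N0 add0r.
have -> : (X%:Z == k) = (X == k) by [].
by rewrite subrr normr0.
Qed.

End CycleSums.

(** * Cycles of negative weight are negligible *)

Section NegativePart.
Variables (R : realType) (th : R) (a : nat -> nat -> int).
Hypothesis th0 : 0 < th.

Lemma Eew_negc_le n : (0 < n)%N ->
  Eew th (fun s : {perm 'I_n} => (negc a s)%:R) <=
    th * expR ((1 + th) ^+ 2) * (\sum_(1 <= j < n)
      ((if a n j <= -1 then j%:R^-1 else 0) * powR (1 - j%:R / n%:R) (th - 1)))
    + expR ((1 + th) ^+ 2) * n%:R `^ (- th).
Proof.
case: n => // n _; have np : 0 < n.+1%:R :> R by [].
set b := fun j => nat_of_bool (a n.+1 j <= -1).
rewrite (@Eew_ext _ _ _ _ (fun s => (cyc_sum b s ^_ 1)%:R)) => [|s]; last by rewrite ffactn1.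
rewrite Eew_ffact fmomS mulr_suml big_ord_recr /= big_add1 /= big_mkord.
have t0 k : fmom th b k 0 = rfrac th k by rewrite fmom0.
apply: lerD.
  rewrite [X in _ <= X]mulr_sumr; apply: ler_sum => j _; rewrite big_ord1 bin0 mul1n ffactn1 subn0 t0.
  rewrite -mulrA -mulrA.
  have jn : (0 < n - j <= n.+1)%N by rewrite subn_gt0 ltn_ord leqW // leq_subr.
  have -> : 1 - j.+1%:R / n.+1%:R = (n - j)%N%:R / n.+1%:R :> R.
    by rewrite -{1}(@divff _ (n.+1%:R : R)) // -mulrBl -natrB ?subSS // ltnS ltnW.
  rewrite subSS /b; case: ifP => _; last by rewrite !mul0r !mulr0.
  rewrite mul1r -[X in _ <= X]mulrA ler_wpM2l ?(ltW th0) //.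
  rewrite [X in _ <= X]mulrCA ler_wpM2l ?invr_ge0 //.
  exact: rfrac_ratio_le.
(* The cycle of full length lies outside the sum over $j<n$; its term is $O(n^{-\theta})$ by
   [rfracV_le]. *)
rewrite big_ord1 bin0 mul1n ffactn1 subnn subn0 t0 rfrac0 mulr1.
have bn : (b n.+1)%:R <= 1 :> R by rewrite /b lern1; case: (_ <= _).
have := rfracV_le th0 (ltn0Sn n) => h.
have -> : n.+1%:R `^ (- th) = n.+1%:R `^ (1 - th) / n.+1%:R :> R.
  rewrite powRD; last by rewrite pnatr_eq0 implybT.
  by rewrite (powRr1 (ler0n R n.+1)) mulrAC divff ?mul1r // pnatr_eq0.
apply: (@le_trans _ _ (th / n.+1%:R / rfrac th n.+1)).
  by rewrite ler_wpM2r ?invr_ge0 ?(ltW (rfrac_gt0 th0 _)) // ler_piMr // divr_ge0 // ltW.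
apply: le_trans (ler_wpM2l _ h) _; first by rewrite divr_ge0 // ltW.
rewrite le_eqVlt; apply/orP; left; apply/eqP.
by move: (expR _) (_ `^ _) => e p; field; rewrite nat1r pnatr_eq0 /= gt_eqF.
Qed.

Hypothesis Hneg : (fun n : nat => \sum_(1 <= j < n)
      ((if a n j <= -1 then j%:R^-1 else 0) *
       powR (1 - j%:R / n%:R) (th - 1))) @ \oo --> (0 : R).

Lemma Eew_negc_cvg0 : (fun n => Eew th (fun s : {perm 'I_n} => (negc a s)%:R)) @ \oo --> (0 : R).
Proof.
have h1 : (fun n : nat => n%:R `^ (- th)) @ \oo --> (0 : R).
  by rewrite -cvg_shiftS /=; apply: powR_neg_cvg0.
pose N n : R := \sum_(1 <= j < n)
      ((if a n j <= -1 then j%:R^-1 else 0) * powR (1 - j%:R / n%:R) (th - 1)).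
have h4 : (fun n => th * expR ((1 + th) ^+ 2) * N n + expR ((1 + th) ^+ 2) * n%:R `^ (- th))
    @ \oo --> (0 : R).
  rewrite -[X in _ --> X](addr0 0) -[X in _ --> X + _](mulr0 (th * expR ((1 + th) ^+ 2))).
  rewrite -[X in _ --> _ + X](mulr0 (expR ((1 + th) ^+ 2))).
  by apply: cvgD; apply: cvgMl_tmp.
apply: squeeze_cvgr (cvg_cst 0) h4; near=> n; apply/andP; split.
  by apply: Eew_ge0.
by apply: Eew_negc_le; near: n; exists 1%N.
Unshelve. all: by end_near. Qed.

End NegativePart.

(** * Iterated limits and the moment method *)

(* Double limits "limit in [m] of the upper limit in [n]" are limits along this filter. *)
Definition iter_oo : set_system (nat * nat) :=
  [set A | \forall m \near \oo, \forall n \near \oo, A (m, n)].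

Global Instance iter_oo_filter : ProperFilter iter_oo.
Proof.
split.
  move=> [M _ /(_ M (leqnn M)) [N _ /(_ N (leqnn N))]] //.
split.
- by apply: nearW => m; apply: nearW.
- move=> A B; rewrite /iter_oo /= => HA HB.
  by apply: (@filterS2 _ \oo _ _ _ _ _ HA HB) => m hA hB; apply: filterI.
- move=> A B AB; rewrite /iter_oo /=; apply: (@filterS _ \oo) => m.
  by apply: (@filterS _ \oo) => n; apply: AB.
Qed.

Section IteratedLimits.
Variable R : realType.

Lemma cvg_snd_iter (u : nat -> R) (c : R) : u @ \oo --> c -> (fun x => u x.2) @ iter_oo --> c.
Proof.
move=> uc; apply/cvgrPdist_lt => e e0.
change (\forall m \near \oo, \forall n \near \oo, `|c - u n| < e); apply: nearW => _.
by move/cvgrPdist_lt: uc => /(_ _ e0).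
Qed.

Lemma limn_esup_iter_cvg (u : nat -> nat -> R) (c : R) :
  (fun m => limn_esup (fun n => (`|u m n - c|)%:E)) @ \oo --> 0%E ->
  (fun x => u x.1 x.2) @ iter_oo --> c.
Proof.
move=> uc; apply/cvgrPdist_lt => e e0.
have : \forall m \near \oo, (limn_esup (fun n => (`|u m n - c|)%:E) < e%:E)%E.
  by apply: (uc [set x | (x < e%:E)%E]); apply: open_ereal_lt'; rewrite lte_fin.
apply: (@filterS _ \oo) => m.
rewrite /limn_esup limf_esupE => /ereal_inf_lt[_ [V FV <-]] h.
apply: (@filterS _ \oo) FV => n Vn /=; rewrite distrC -lte_fin; apply: le_lt_trans h.
by apply: ereal_sup_ubound; exists n.
Qed.

End IteratedLimits.

Section LimitTools.
Variable R : realType.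

Lemma cvg_fst_iter (u : nat -> R) (c : R) : u @ \oo --> c -> (fun x => u x.1) @ iter_oo --> c.
Proof.
move=> uc; apply/cvgrPdist_lt => e e0.
change (\forall m \near \oo, \forall n \near \oo, `|c - u m| < e).
by move/cvgrPdist_lt: uc => /(_ _ e0); apply: (@filterS _ \oo) => m h; apply: nearW.
Qed.

Lemma cvg0_norm_le (T : Type) (F : set_system T) (f g : T -> R) : Filter F ->
  (\forall x \near F, `|f x| <= g x) -> g @ F --> (0 : R) -> f @ F --> (0 : R).
Proof.
move=> FF fg /cvgr0Pnorm_lt g0; apply/cvgr0Pnorm_lt => e e0.
apply: (filterS2 _ _ fg (g0 _ e0)) => x h1; apply: le_lt_trans.
exact: le_trans h1 (ler_norm _).
Qed.

Lemma cvg_invn : (fun n : nat => n%:R^-1) @ \oo --> (0 : R).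
Proof. by rewrite -cvg_shiftS /=; exact: cvg_harmonic. Qed.

Lemma cvg_big_sum (T : Type) (F : set_system T) (K : nat) (f : nat -> T -> R) (l : nat -> R) :
  Filter F -> (forall i, f i @ F --> l i) ->
  (fun x => \sum_(i < K) f i x) @ F --> (\sum_(i < K) l i : R).
Proof. by move=> FF fl; apply: cvg_big => // ; exact: add_continuous. Qed.

Lemma cauchy_cvg_nat (u : nat -> R) :
  (forall e, 0 < e -> exists c, \forall n \near \oo, `|c - u n| < e) -> cvg (u @ \oo).
Proof.
move=> H; apply/cauchy_cvgP; apply: cauchy_exP => e e0.
by have [c hc] := H e e0; exists c.
Qed.

Lemma cdf_natE (p : nat -> R) x K : (forall k : nat, (k%:R <= x) = (k < K)%N) ->
  cdf_nat p x = \sum_(k < K) p k.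
Proof.
move=> xK; apply: norm_lim_near_cst; near=> n.
rewrite /series /= big_mkord (big_ord_widen n p); last by near: n; exists K.
by rewrite [RHS]big_mkcond; apply: eq_bigr => k _; rewrite xK.
Unshelve. all: by end_near. Qed.

(** [K] is the ceiling of [x], or 0 for negative [x]. *)
Lemma lt_nat_threshold (x : R) : exists K : nat, forall k : nat, (k%:R < x) = (k < K)%N.
Proof.
have ex : exists k : nat, x <= k%:R.
  by exists (Num.bound `|x|); apply: le_trans (ler_norm x) (ltW (archi_boundP (normr_ge0 x))).
exists (ex_minn ex); case: ex_minnP => K xK Kmin k.
apply/idP/idP => [kx|]; last by apply: contraTT; rewrite -leNgt -leqNgt; exact: Kmin.
by rewrite -(ltr_nat R); apply: lt_le_trans xK.
Qed.

(** $T_n$ uses a strict inequality and [cdf_nat] a weak one; they disagree only at an integer $x=K$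
    with $p_K>0$, where [cdf_nat] jumps. *)
Lemma cdf_nat_continuous (p : nat -> R) x K : (forall k, 0 <= p k) ->
  (forall k : nat, (k%:R < x) = (k < K)%N) -> {for x, continuous (cdf_nat p)} ->
  cdf_nat p x = \sum_(k < K) p k.
Proof.
move=> p0 xK cx.
have xleK : x <= K%:R by rewrite leNgt xK ltnn.
have [xe|xne] := eqVneq x K%:R; last first.
  apply: cdf_natE => k; rewrite le_eqVlt xK; apply/orP/idP => [[/eqP kx|//]|]; last by right.
  exfalso; move: xne; rewrite -kx eqr_nat => /negP[]; rewrite eqn_leq.
  by rewrite -(ler_nat R) kx xleK leqNgt -xK kx ltxx.
have cxE : cdf_nat p x = \sum_(k < K) p k + p K.
  rewrite (@cdf_natE p x K.+1) ?big_ord_recr // => k.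
  by rewrite xe ler_nat ltnS.
rewrite cxE; have [pK|] := leP (p K) 0.
  by rewrite (@le_anti _ _ (p K) 0) ?addr0 // pK p0.
move=> pK; exfalso; move/cvgrPdist_lt: cx => /(_ _ pK).
move=> /nbhs_ballP[d /= d0 hd].
(* A point in the continuity ball with $x-1\le y<x$, so exactly the $k<K$ lie at or below it. *)
pose y := x - Num.min d 1 / 2.
have m0 : 0 < Num.min d 1 by rewrite lt_min d0 ltr01.
have m1 : Num.min d 1 <= 1 by rewrite ge_min lexx orbT.
have md : Num.min d 1 <= d by rewrite ge_min lexx.
have yx : y < x by rewrite /y; lra.
have xy : x - 1 <= y by rewrite /y; lra.
have /hd : ball x d y.
  by rewrite /ball /= /y opprB addrC subrK ger0_norm; lra.
rewrite (@cdf_natE p y K) => [|k]; last first.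
  apply/idP/idP => [ky|kK]; first by rewrite -xK; apply: le_lt_trans yx.
  apply: le_trans xy; rewrite xe lerBrDr natr1 ler_nat //.
by rewrite cxE addrAC subrr add0r ger0_norm ?p0 // ltxx.
Qed.

End LimitTools.

(** * Convergence of the laws and of their factorial moments *)

Section MomentMethod.
Variables (R : realType) (th : R) (a : nat -> nat -> int) (Upsilon : nat -> R).
Hypothesis th0 : 0 < th.
Hypothesis Hneg : (fun n : nat => \sum_(1 <= j < n)
      ((if a n j <= -1 then j%:R^-1 else 0) *
       powR (1 - j%:R / n%:R) (th - 1))) @ \oo --> (0 : R).
Hypothesis U0 : Upsilon 0%N = 1.
Hypothesis HU : forall l : nat, (0 < l)%N ->
     (fun m : nat =>
        limn_esup (fun n : nat => (`|Ups th a n l m - Upsilon l|)%:E))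
       @ \oo --> 0%E.
Hypothesis HS : cvg (series (fun l : nat => Upsilon l * 2 ^+ l / (l`!)%:R) @ \oo).

(* A pair [x] stands for [(m, n)]: truncation level [x.1], permutations of [x.2] points. *)
Definition cut_sum (x : nat * nat) : {perm 'I_x.2} -> nat := @cyc_sum (bcut a x.2 x.1) x.2.

Definition cut_moment l x : R := Eew th (fun s => (@cut_sum x s ^_ l)%:R).

Definition cut_law k x : R := Eew th (fun s => (@cut_sum x s == k)%:R).

Definition hn_law (k n : nat) : R := Eew th (fun s : {perm 'I_n} => (hn a s == k)%:R).

(** For each fixed [m] the weights are bounded by [m] and [moment_error_cvg0] applies; the iterated
    limit requires no uniformity in [m]. *)
Lemma moment_cvg l : cut_moment l @ iter_oo --> Upsilon l.
Proof.
case: l => [|l].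
  rewrite U0; have -> : cut_moment 0 = fun=> 1; last exact: cvg_cst.
  apply/funext => x; rewrite -(Eew1 th0 x.2); apply: Eew_ext => s; by rewrite ffactn0.
have h1 := limn_esup_iter_cvg (u := fun m n => Ups th a n l.+1 m) (HU (ltn0Sn l)).
have h2 : (fun x => cut_moment l.+1 x - Ups th a x.2 l.+1 x.1) @ iter_oo --> (0 : R).
  apply/cvgrPdist_lt => e e0.
  change (\forall m \near \oo, \forall n \near \oo,
    `|0 - (cut_moment l.+1 (m, n) - Ups th a n l.+1 m)| < e); apply: nearW => m.
  have := @moment_error_cvg0 R th th0 (fun n => bcut a n m) m l.+1 (fun n j => geq_minr _ _).
  move/cvgrPdist_lt => /(_ _ e0); apply: (@filterS _ \oo) => n.
  by rewrite Ups_comp_tot // /cut_moment Eew_ffact.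
rewrite -[X in _ --> X]add0r.
have -> : cut_moment l.+1 = fun x => (cut_moment l.+1 x - Ups th a x.2 l.+1 x.1) + Ups th a x.2 l.+1 x.1.
  by apply/funext => x; rewrite subrK.
exact: cvgD.
Qed.

Lemma moment_lim_ge0 l : 0 <= Upsilon l.
Proof.
apply: (ler_cvg_to (cvg_cst 0) (moment_cvg (l := l))); apply: nearW => x.
by apply: Eew_ge0.
Qed.

Lemma law_cut_diff k : (fun x => hn_law k x.2 - cut_law k x) @ iter_oo --> (0 : R).
Proof.
have h1 := cvg_snd_iter (Eew_negc_cvg0 th0 Hneg).
have h2 := cvg_fst_iter (@cvg_invn R).
have h3 : (fun x => Eew th (fun s : {perm 'I_x.2} => (negc a s)%:R) + x.1%:R^-1 * cut_moment 1 x)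
    @ iter_oo --> (0 : R).
  rewrite -[X in _ --> X](addr0 0) -[X in _ --> _ + X](mul0r (Upsilon 1)).
  by apply: cvgD => //; apply: cvgM => //; exact: moment_cvg.
apply: cvg0_norm_le h3.
change (\forall m \near \oo, \forall n \near \oo, `|hn_law k n - cut_law k (m, n)| <=
  Eew th (fun s : {perm 'I_n} => (negc a s)%:R) + m%:R^-1 * cut_moment 1 (m, n)).
near=> m; have m0 : (0 < m)%N by near: m; exists 1%N.
apply: nearW => n; rewrite /cut_moment -EewZ -EewD; apply: Eew_norm_le => // s.
by rewrite ffactn1; apply: hn_cut_eq.
Unshelve. all: by end_near. Qed.

Lemma bonferroni_moments k L x :
  `|cut_law k x - \sum_(i < L.+1) (-1) ^+ i * 'C(k + i, k)%:R / (k + i)`!%:R * cut_moment (k + i) x| <=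
  'C(k + L.+1, k)%:R / (k + L.+1)`!%:R * cut_moment (k + L.+1) x.
Proof.
have binE j y : 'C(y, j)%:R = j`!%:R^-1 * (y ^_ j)%:R :> R.
  by rewrite -bin_ffact natrM mulrCA mulVf ?mulr1 // pnatr_eq0 -lt0n fact_gt0.
under eq_bigr => i _ do rewrite -EewZ.
rewrite -Eew_sum -EewZ; apply: Eew_norm_le => // s.
have := @bonferroni R (@cut_sum x s) k L; rewrite natrM (binE _ (@cut_sum x s)) mulrA.
under eq_bigr => i _ do rewrite natrM (binE _ (@cut_sum x s)) !mulrA.
by [].
Qed.

(** Since $\binom Nk\le 2^N$, the expression is dominated by a term of the convergent series [HS];
    this is the role of the factor $2^l$. *)
Lemma Upsilon_tail (e : R) k : 0 < e -> exists L,
  'C(k + L.+1, k)%:R / (k + L.+1)`!%:R * Upsilon (k + L.+1)%N < e.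
Proof.
move=> e0; have := cvg_series_cvg_0 HS; move/cvgr0Pnorm_lt => /(_ _ e0) [M _ hM].
exists M; have := hM (k + M.+1)%N; rewrite /= => /(_ _) h.
apply: le_lt_trans (h _); last by rewrite addnS ltnW // ltnS leq_addl.
apply: le_trans (ler_norm _).
rewrite mulrC mulrA ler_wpM2r ?invr_ge0 // ler_wpM2l ?moment_lim_ge0 //.
rewrite -natrX ler_nat; set N := (k + M.+1)%N.
have kN : (k < N.+1)%N by rewrite ltnS leq_addr.
have := Pascal 1 1 N; rewrite addn1 => ->.
by rewrite (bigD1 (Ordinal kN)) //= !exp1n !muln1 leq_addr.
Qed.

Lemma law_cvg k : cvg (hn_law k @ \oo).
Proof.
apply: cauchy_cvg_nat => e e0.
have e4 : 0 < e / 4 by rewrite divr_gt0.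
have [L hL] := Upsilon_tail k e4.
pose c i : R := (-1) ^+ i * 'C(k + i, k)%:R / (k + i)`!%:R.
pose S x := \sum_(i < L.+1) c i * cut_moment (k + i) x.
(* The Bonferroni sum with limiting moments serves as centre for the Cauchy criterion. *)
pose sL := \sum_(i < L.+1) c i * Upsilon (k + i)%N.
exists sL.
have hS : S @ iter_oo --> sL.
  apply: (@cvg_big_sum _ _ _ _ (fun i x => c i * cut_moment (k + i)%N x) (fun i => c i * Upsilon (k + i)%N)).
  by move=> i; apply: cvgMl_tmp; exact: moment_cvg.
pose d : R := 'C(k + L.+1, k)%:R / (k + L.+1)`!%:R.
have hR : (fun x => d * cut_moment (k + L.+1)%N x) @ iter_oo --> d * Upsilon (k + L.+1)%N.
  by apply: cvgMl_tmp; exact: moment_cvg.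
have hR4 : \forall x \near iter_oo, d * cut_moment (k + L.+1)%N x < e / 4 by exact: (cvgr_lt _ hR).
move/cvgrPdist_lt: hS => /(_ _ e4) hS.
move/cvgr0Pnorm_lt: (law_cut_diff k) => /(_ _ e4) hP.
have : \forall x \near iter_oo, `|sL - hn_law k x.2| < e.
  near=> x.
  have h1 : `|sL - S x| < e / 4 by near: x.
  have h2 : `|hn_law k x.2 - cut_law k x| < e / 4 by near: x.
  have h3 : d * cut_moment (k + L.+1)%N x < e / 4 by near: x.
  have h4 := bonferroni_moments k L x; rewrite -/(S x) in h4.
  have -> : sL - hn_law k x.2 = (sL - S x) - (hn_law k x.2 - cut_law k x) - (cut_law k x - S x) by ring.
  apply: le_lt_trans (ler_normB _ _) _; apply: le_lt_trans (lerD (ler_normB _ _) h4) _.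
  by rewrite -/d; lra.
(* [hn_law] does not involve the truncation level, so a single good level yields the bound for all
   large [n]. *)
by case=> M _ /(_ M (leqnn M)).
Unshelve. all: by end_near. Qed.

Definition limit_law k : R := lim (hn_law k @ \oo).

Lemma law_cut_cvg k : cut_law k @ iter_oo --> limit_law k.
Proof.
have -> : cut_law k = fun x => hn_law k x.2 - (hn_law k x.2 - cut_law k x).
  by apply/funext => x; rewrite opprB addrC subrK.
rewrite -[X in _ --> X]subr0; apply: cvgB; last exact: law_cut_diff.
exact: (cvg_snd_iter (@law_cvg k)).
Qed.

Lemma lim_law_ge0 k : 0 <= limit_law k.
Proof.
apply: (ler_cvg_to (cvg_cst 0) (law_cut_cvg (k := k))); apply: nearW => x.
by apply: Eew_ge0.
Qed.

(* On [X >= K], [X_(l) <= X_(l+1) / (K - l)], which gives uniform integrability. *)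
Lemma truncated_moment_bounds l K : (l < K)%N ->
  Upsilon l - (K - l)%:R^-1 * Upsilon l.+1 <= \sum_(k < K) (k ^_ l)%:R * limit_law k <= Upsilon l.
Proof.
move=> lK; pose T x := \sum_(k < K) (k ^_ l)%:R * cut_law k x.
have hT : T @ iter_oo --> \sum_(k < K) (k ^_ l)%:R * limit_law k.
  apply: (@cvg_big_sum _ _ _ _ (fun k x => (k ^_ l)%:R * cut_law k x) (fun k => (k ^_ l)%:R * limit_law k)).
  by move=> k; apply: cvgMl_tmp; exact: law_cut_cvg.
have TE x : T x = Eew th (fun s => (@cut_sum x s ^_ l)%:R * (@cut_sum x s < K)%N%:R).
  rewrite /T; under eq_bigr => k _ do rewrite -EewZ.
  rewrite -Eew_sum; apply: Eew_ext => s; case: ltnP => XK.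
    rewrite (bigD1 (Ordinal XK)) //= eqxx big1 ?addr0 // => k kX.
    by rewrite eq_sym (negbTE (_ : val k != cut_sum s)) ?mulr0.
  rewrite mulr0 big1 // => k _; rewrite gtn_eqF ?mulr0 //.
  by apply: leq_trans XK.
have lo : (fun x => cut_moment l x - (K - l)%:R^-1 * cut_moment l.+1 x) @ iter_oo -->
     Upsilon l - (K - l)%:R^-1 * Upsilon l.+1.
  by apply: cvgB; [|apply: cvgMl_tmp]; exact: moment_cvg.
have Kl0 : 0 < (K - l)%:R :> R by rewrite ltr0n subn_gt0.
apply/andP; split.
  apply: (ler_cvg_to lo hT); apply: nearW => x; rewrite TE /cut_moment -EewZ -EewB.
  apply: Eew_le => // s; case: ltnP => XK.
    by rewrite mulr1 gerBl mulr_ge0 // invr_ge0 ltW.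
  rewrite mulr0 subr_le0 mulrC ler_pdivlMr // -natrM ler_nat ffactnSr leq_mul2l.
  by rewrite leq_sub2r ?orbT.
apply: (ler_cvg_to hT (moment_cvg (l := l))); apply: nearW => x; rewrite TE /cut_moment.
by apply: Eew_le => // s; case: (_ < K)%N; rewrite ?mulr1 // mulr0.
Qed.

Lemma lim_law_moment l :
  series (fun k : nat => (k ^_ l)%:R * limit_law k) @ \oo --> Upsilon l.
Proof.
have lo : (fun K => Upsilon l - (K - l)%:R^-1 * Upsilon l.+1) @ \oo --> Upsilon l.
  rewrite -[X in _ --> X]subr0 -[X in _ --> _ - X](mul0r (Upsilon l.+1)).
  apply: cvgB; first exact: cvg_cst.
  apply: cvgMr_tmp; have := @cvg_invn R; by rewrite -(cvg_centern l).
apply: (squeeze_cvgr _ lo (cvg_cst _)); near=> K; rewrite /series /= big_mkord.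
by apply: truncated_moment_bounds; near: K; exists l.+1.
Unshelve. all: by end_near. Qed.

(** Summing $\mathbf 1\{h=k\}$ over $k<K$ gives $\mathbf 1\{0\le h<x\}$, which differs from $\mathbf
    1\{h<x\}$ only if some cycle has negative weight. *)
Lemma Tn_cvg x K : (forall k : nat, (k%:R < x) = (k < K)%N) ->
  (fun n => Tn th a n x) @ \oo --> \sum_(k < K) limit_law k.
Proof.
move=> xK; have h1 : (fun n => Tn th a n x - \sum_(k < K) hn_law k n) @ \oo --> (0 : R).
  apply: cvg0_norm_le (Eew_negc_cvg0 th0 Hneg); apply: nearW => n.
  rewrite /Tn ewensE -Eew_sum; apply: Eew_norm_le => // s.
  have sumE : \sum_(k < K) (hn a s == k)%:R =
      ((0 <= hn a s) && ((hn a s)%:~R < x))%:R :> R.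
    case: (hn a s) => [h|h] /=; last by rewrite big1.
    rewrite -pmulrn xK; case: ltnP => hK.
      rewrite (bigD1 (Ordinal hK)) //= eqxx big1 ?addr0 // => k kh.
      by rewrite (_ : (Posz h == k) = false) //; apply/negbTE; rewrite eqz_nat eq_sym.
    rewrite big1 // => k _; rewrite (_ : (Posz h == k) = false) //.
    by rewrite eqz_nat gtn_eqF //; apply: leq_trans hK.
  rewrite sumE; case: (eqVneq (negc a s) 0%N) => [N0|].
    by rewrite hn_ge0 // subrr normr0.
  rewrite -lt0n => N0; apply: (@le_trans _ _ 1); last by rewrite ler1n.
  by case: (_ < x); case: (_ <= hn a s); rewrite ?subrr ?subr0 ?normr0 ?normr1.
rewrite -[X in _ --> X]add0r.
have -> : (fun n => Tn th a n x) = fun n => (Tn th a n x - \sum_(k < K) hn_law k n) + \sum_(k < K) hn_law k n.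
  by apply/funext => n; rewrite subrK.
apply: cvgD => //; apply: (@cvg_big_sum _ _ _ _ hn_law limit_law) => k; exact: law_cvg.
Qed.

End MomentMethod.


Theorem theorem2 (R : realType) (th : R) (a : nat -> nat -> int)
  (Upsilon : nat -> R) :
  0 < th ->
  (fun n : nat => \sum_(1 <= j < n)
      ((if a n j <= -1 then j%:R^-1 else 0) *
       powR (1 - j%:R / n%:R) (th - 1))) @ \oo --> (0 : R) ->
  Upsilon 0%N = 1 ->
  (forall l : nat, (0 < l)%N ->
     (fun m : nat =>
        limn_esup (fun n : nat => (`|Ups th a n l m - Upsilon l|)%:E))
       @ \oo --> 0%E) ->
  cvg (series (fun l : nat => Upsilon l * 2 ^+ l / (l`!)%:R) @ \oo) ->
  exists p : nat -> R,
    [/\ (forall k, 0 <= p k),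
        series p @ \oo --> (1 : R),
        (forall x : R, {for x, continuous (cdf_nat p)} ->
           (fun n : nat => Tn th a n x) @ \oo --> cdf_nat p x) &
        (forall l : nat, (0 < l)%N ->
           series (fun k : nat => (k ^_ l)%:R * p k) @ \oo --> Upsilon l)].
Proof.
move=> th0 Hneg U0 HU HS.
have mom := lim_law_moment th0 Hneg U0 HU HS.
have p0 := lim_law_ge0 th0 Hneg U0 HU HS.
exists (limit_law th a); split=> // [|x cx].
  (* The moment identity for $l=0$ is the statement that the total mass is 1. *)
  have := mom 0%N; rewrite U0.
  have -> // : (fun k : nat => (k ^_ 0)%:R * limit_law th a k) = limit_law th a.
  by apply/funext => k; rewrite ffactn0 mul1r.
have [K xK] := lt_nat_threshold x.
by rewrite (cdf_nat_continuous p0 xK cx); apply: (Tn_cvg th0 Hneg U0 HU HS).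
Qed.
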